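(* For all $r\in[0,\infty)$ and every fixed $k\in\mathbb{N}_0$ such that $\max\{k,r\}>0$ there is $N\in\mathbb{N}$ such that for all integers $n>N$, all maximizers of the function $i\mapsto\mathbb{P}[\mathrm{Lah}(n,k)_r=i]$ are among the following two numbers: $$\left\lfloor(k+r)\log n-\frac{(k+r)\Gamma'(k+2r)}{\Gamma(k+2r)}-\frac12\right\rfloor,\qquad\left\lceil(k+r)\log n-\frac{(k+r)\Gamma'(k+2r)}{\Gamma(k+2r)}-\frac12\right\rceil.$$
   Context: $\mathbb{N}=\{1,2,\ldots\}$, $\mathbb{N}_0=\mathbb{N}\cup\{0\}$. Let $\genfrac{[}{]}{0pt}{}{n}{k}$ and $\genfrac{\{}{\}}{0pt}{}{n}{k}$ be the (unsigned) Stirling numbers of the first kind (number of permutations of $\{1,\dots,n\}$ with exactly $k$ cycles) and of the second kind (number of partitions of $\{1,\dots,n\}$ into $k$ non-empty subsets). For $n\in\mathbb{N}_0$, $k\in\{0,\ldots,n\}$ and $r\in\mathbb{R}$ the $r$-Stirling numbers are defined (with $0^0=1$) by $$\genfrac{[}{]}{0pt}{}{n}{k}_r=\sum_{j=k}^n\genfrac{[}{]}{0pt}{}{n}{j}\binom{j}{k}r^{j-k},\qquad \genfrac{\{}{\}}{0pt}{}{n}{k}_r=\sum_{j=k}^n\binom{n}{j}\genfrac{\{}{\}}{0pt}{}{j}{k}r^{n-j}.$$ The $r$-Lah number is $L(n,k)_r=\sum_{j=k}^n\genfrac{[}{]}{0pt}{}{n}{j}_r\genfrac{\{}{\}}{0pt}{}{j}{k}_r$.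 For $n\in\mathbb{N}$, $k\in\{0,\ldots,n\}$, $r\in[0,\infty)$ with $\max\{k,r\}>0$, $\mathrm{Lah}(n,k)_r$ denotes a random variable with the $r$-Lah distribution $$\mathbb{P}[\mathrm{Lah}(n,k)_r=j]=\frac{1}{L(n,k)_r}\genfrac{[}{]}{0pt}{}{n}{j}_r\genfrac{\{}{\}}{0pt}{}{j}{k}_r,\qquad j\in\{k,k+1,\ldots,n\}.$$ $\Gamma$ is Euler's Gamma function and $\Gamma'$ its derivative. *)

(* Defs.v *)
From HB Require Import structures.
From mathcomp Require Import all_boot all_order all_algebra all_fingroup.

Set Implicit Arguments.
Unset Strict Implicit.
Unset Printing Implicit Defensive.

(* These precede the import of mathcomp-classical, which shadows [partition] and
   the finite-set notations. *)
Definition stirling1 (n k : nat) : nat :=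
  #|[set s : 'S_n | #|porbits s| == k]|.

Definition stirling2 (n k : nat) : nat :=
  #|[set P : {set {set 'I_n}} | partition P [set: 'I_n] & #|P| == k]|.

From mathcomp Require Import all_classical all_reals all_analysis.
Import Order.TTheory GRing.Theory Num.Theory.
Import numFieldNormedType.Exports.

Local Open Scope classical_set_scope.
Local Open Scope ring_scope.

Definition rstirling1 (R : realType) (r : R) (n k : nat) : R :=
  \sum_(k <= j < n.+1) (stirling1 n j)%:R * 'C(j, k)%:R * r ^+ (j - k).

Definition rstirling2 (R : realType) (r : R) (n k : nat) : R :=
  \sum_(k <= j < n.+1) 'C(n, j)%:R * (stirling2 j k)%:R * r ^+ (n - j).

Definition rlah (R : realType) (r : R) (n k : nat) : R :=
  \sum_(k <= j < n.+1) rstirling1 r n j * rstirling2 r j k.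

(* The probability that a variable with the r-Lah distribution of parameters
   n and k equals j, for arbitrary j (so 0 off the support {k, ..., n}). *)
Definition rlah_pmf (R : realType) (r : R) (n k j : nat) : R :=
  if (k <= j <= n)%N
  then (rlah r n k)^-1 * (rstirling1 r n j * rstirling2 r j k)
  else 0.

(* Euler's integral; meaningful for x > 0 only. *)
Definition Gamma (R : realType) (x : R) : R :=
  \int[@lebesgue_measure R]_(t in `]0, +oo[) (t `^ (x - 1) * expR (- t)).

Definition is_maximizer (R : realType) (f : nat -> R) (i : nat) : Prop :=
  forall j : nat, f j <= f i.

Definition rlah_mode_approx (R : realType) (r : R) (n k : nat) : R :=
  (k%:R + r) * ln n%:R
  - (k%:R + r) * derive1 (@Gamma R) (k%:R + 2 * r) / Gamma (k%:R + 2 * r)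
  - 1 / 2.

(* Main.v *)
(* Write [t = k + r] and [x = t + r]. Up to a factor independent of [j], the
   weight [rstirling1 r n j * t ^+ j] is the probability [p_j] that [n]
   independent trials with success probabilities [t / (x + i)], [i < n], have
   [j] successes, and [rstirling2 r j k / t ^+ j] is nondecreasing in [j] with
   ratio [1 + o(1/j)] between consecutive terms. Deleting one trial at a time
   gives [j p_j - m p_(j-1) = O(p_(j-1) / m)] near the mean [m] of the number of
   successes, because the squares of the success probabilities have a bounded
   sum; cruder bounds hold away from the mean. So every mode lies in
   [(m - 1 - o(1), m + o(1))]. Finally
   [m = t * \sum_(i < n) (x + i)^-1 = t * (ln n - psi x) + o(1)], where
   [psi = Gamma' / Gamma] is controlled by Wendel's inequality
   [Gamma (y + h) <= y `^ h * Gamma y]. *)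
Require Import Defs.
From HB Require Import structures.
From mathcomp Require Import all_boot all_order all_algebra all_fingroup.
From mathcomp Require Import ring lra.

Set Implicit Arguments.
Unset Strict Implicit.
Unset Printing Implicit Defensive.

Import Order.TTheory GRing.Theory Num.Theory.

Local Open Scope ring_scope.

(** * Stirling numbers *)

Section StirlingFirst.
Variables (T : finType) (R : idomainType).
Implicit Types (D : {set T}) (s : {perm T}) (x y : T).

(** Orbits are counted in all of [T], so each point outside [D] is a fixed point and contributes a
    factor ['X]; hence the powers of ['X] that balance [cycle_polyE]. *)
Definition cycle_poly D : {poly R} :=
  \sum_(s : {perm T} | perm_on D s) 'X^#|porbits s|.

(** The left factor acts first, so [tperm x y * s] sends [y] to [s x], which is [x] when [s] is
    supported on [D]. This sorts the permutations of [x |: D] by the preimage [y] of [x], with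
    [y = x] allowed. *)
Lemma perm_on_tperm_mul D x y s : x \notin D -> y \in x |: D ->
  perm_on (x |: D) (tperm x y * s)%g && ((tperm x y * s)%g y == x) = perm_on D s.
Proof.
move=> xD yD; rewrite permM tpermR.
have ton : perm_on (x |: D) (tperm x y).
  apply: subset_trans (tperm_on x y) _.
  by rewrite subUset !sub1set setU11 yD.
apply/andP/idP => [[son /eqP sx]|son].
  have son' : perm_on (x |: D) s.
    by rewrite -[s](mulKg (tperm x y)) tpermV perm_onM.
  apply/subsetP => z; rewrite inE => szz.
  have /setU1P[zx|//] := subsetP son' z szz.
  by rewrite zx sx eqxx in szz.
split; last by rewrite (out_perm son).
by apply: perm_onM => //; exact: subset_trans son (subsetUr _ _).
Qed.

(** [x] is a fixed point of [s], hence outside the cycle of [y], and multiplying by a transposition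
    of points in two different cycles merges these cycles. *)
Lemma card_porbits_tperm_mul D x y s :
  x \notin D -> y \in D -> perm_on D s ->
  (#|porbits (tperm x y * s)|.+1 = #|porbits s|)%N.
Proof.
move=> xD yD son; have xy : x != y by apply: contraNneq xD => ->.
have xNy : x \notin porbit s y.
  rewrite porbit_sym; apply/porbitP => -[i yE].
  have fixx j : (s ^+ j)%g x = x.
    elim: j => [|j IH]; first by rewrite perm1.
    by rewrite expgSr permM IH (out_perm son).
  by rewrite yE fixx eqxx in xy.
by have := porbits_mul_tperm s x y; rewrite /= xNy xy addn1 addn2 => -[].
Qed.

(** Sort by the preimage [y] of [x]: for [y = x] the number of cycles is that of [s], for each of
    the [#|D|] other choices it is one less. The factor ['X] on the left avoids a division. *)
Lemma cycle_polyU1 D x : x \notin D ->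
  'X * cycle_poly (x |: D) = ('X + #|D|%:R%:P) * cycle_poly D.
Proof.
move=> xD.
have -> : cycle_poly (x |: D) = \sum_(y in x |: D)
    \sum_(s | perm_on D s) 'X^#|porbits (tperm x y * s)%g|.
  rewrite /cycle_poly (partition_big (fun s : {perm T} => s^-1%g x)
    (mem (x |: D))) /=; last first.
    by move=> s son; rewrite (perm_closed _ (perm_onV son)) setU11.
  apply: eq_bigr => y yD.
  rewrite (reindex_onto (fun s => tperm x y * s)%g (fun s => tperm x y * s)%g);
    last by move=> s _; rewrite mulgA tperm2 mul1g.
  apply: eq_bigl => s; rewrite mulgA tperm2 mul1g eqxx andbT.
  rewrite -(perm_on_tperm_mul s xD yD); congr (_ && _).
  by rewrite -(inj_eq (@perm_inj _ (tperm x y * s)%g)) permKV eq_sym.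
rewrite big_setU1 //= tperm1 mulrDr mulrDl.
congr (_ + _).
  by congr (_ * _); apply: eq_bigr => s _; rewrite mul1g.
rewrite polyC_natr mulr_natl -sumr_const mulr_sumr; apply: eq_bigr => y yD.
rewrite mulr_sumr; apply: eq_bigr => s son.
by rewrite -exprS (card_porbits_tperm_mul xD yD son).
Qed.

Lemma cycle_polyE D :
  'X^#|D| * cycle_poly D = 'X^#|T| * \prod_(i < #|D|) ('X + i%:R%:P).
Proof.
move Dn : #|D| => n; elim: n => [|n IH] in D Dn *.
  move/eqP: Dn; rewrite cards_eq0 => /eqP ->.
  rewrite big_ord0 mulr1 expr0 mul1r /cycle_poly (big_pred1 1%g); last first.
    move=> s /=; apply/idP/eqP => [son|->]; last exact: perm_on1.
    by apply: perm_on_id son _; rewrite cards0.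
  congr ('X^_); rewrite /porbits card_imset //.
  move=> x y /eqP; rewrite eq_porbit_mem => /porbitP[i].
  by rewrite expg1n perm1.
have [x xD] : exists x, x \in D by apply/set0Pn; rewrite -card_gt0 Dn.
have cD : #|D :\ x| = n by move: Dn; rewrite (cardsD1 x) xD => -[].
rewrite -(setD1K xD) exprSr -mulrA cycle_polyU1 ?setD11 // cD.
by rewrite big_ord_recr /= [RHS]mulrA -(IH _ cD) -!mulrA [cycle_poly _ * _]mulrC.
Qed.

End StirlingFirst.

Lemma stirling1_poly (R : idomainType) n :
  \sum_(j < n.+1) (stirling1 n j)%:R *: 'X^j
    = \prod_(i < n) ('X + i%:R%:P) :> {poly R}.
Proof.
have Xn0 : 'X^n != 0 :> {poly R} by rewrite monic_neq0 ?monicXn.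
apply: (mulfI Xn0); have := cycle_polyE R [set: 'I_n].
rewrite cardsT card_ord => <-; congr (_ * _).
have le_c (s : 'S_n) : (#|porbits s| < n.+1)%N.
  by rewrite ltnS -[X in (_ <= X)%N]card_ord; apply: leq_imset_card.
rewrite /cycle_poly [RHS](eq_bigl xpredT); last first.
  by move=> s; have -> // : perm_on [set: 'I_n] s by apply/subsetP => x; rewrite !inE.
rewrite [RHS](partition_big (fun s : 'S_n => Ordinal (le_c s)) xpredT) //=.
apply: eq_bigr => j _.
rewrite [RHS](eq_bigr (fun=> 'X^j)); last by move=> s /eqP <-.
by rewrite sumr_const -scaler_nat /stirling1 cardsE.
Qed.

(** * Second kind: set partitions, one point at a time *)

Lemma setD1id (T : finType) (A : {set T}) a : a \notin A -> A :\ a = A.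
Proof.
move=> aA; apply/setP => x; rewrite !inE.
by case: eqVneq => // ->; rewrite (negbTE aA).
Qed.

Section StirlingSecond.
Variables (T : finType).
Implicit Types (D B : {set T}) (P Q : {set {set T}}) (x : T).

(** The second component is the block that [x] joins; [set0], which is never a block, encodes that
    [x] becomes a new singleton. *)
Definition add_point x (PB : {set {set T}} * {set T}) : {set {set T}} :=
  (x |: PB.2) |: (PB.1 :\ PB.2).

Definition del_point x Q : {set {set T}} * {set T} :=
  let B := pblock Q x :\ x in
  ((if B == set0 then set0 else [set B]) :|: (Q :\ pblock Q x), B).

Lemma partition_add_point D x P B :
  x \notin D -> partition P D -> B \in set0 |: P ->
  partition (add_point x (P, B)) (x |: D).
Proof.
move=> xD PD BP; rewrite /add_point /=.
have PBD : partition (P :\ B) (D :\: B).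
  case/setU1P: BP => [->|BP]; last exact: partitionD1.
  by rewrite setD1id ?(partition0 PD) // setD0.
have BD : B \subset D.
  by case/setU1P: BP => [->|]; [rewrite sub0set|exact: partitionS PD].
have -> : x |: D = (x |: B) :|: (D :\: B).
  apply/setP => y; rewrite !inE; have := subsetP BD y.
  by case: (y \in B) => [->|_] //; rewrite orbF.
apply: partitionU1 => //; first by apply/set0Pn; exists x; rewrite setU11.
rewrite disjoints_subset; apply/subsetP => y /setU1P[->|yB]; rewrite !inE.
  by rewrite (negbTE xD) andbF.
by rewrite yB.
Qed.

Lemma partition_pblock D Q x : partition Q (x |: D) ->
  [/\ x \in pblock Q x, pblock Q x \in Q & x |: (pblock Q x :\ x) = pblock Q x].
Proof.
move=> QD; have xQ : x \in cover Q by rewrite (cover_partition QD) setU11.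
have xA : x \in pblock Q x by rewrite mem_pblock.
by split=> //; [exact: pblock_mem|exact: setD1K].
Qed.

Lemma partition_del_point D x Q : x \notin D -> partition Q (x |: D) ->
  partition (del_point x Q).1 D /\ (del_point x Q).2 \in set0 |: (del_point x Q).1.
Proof.
move=> xD QD; have [xA AQ AE] := partition_pblock QD.
rewrite /del_point /=; set A := pblock Q x in xA AQ AE *.
have QAD := partitionD1 QD AQ.
case: ifPn => [/eqP B0|Bn0]; last first.
  split; last by rewrite !inE eqxx orbT.
  have -> : D = (A :\ x) :|: ((x |: D) :\: A).
    have AD : A \subset x |: D by exact: partitionS QD AQ.
    apply/setP => y; rewrite !inE; have := subsetP AD y; rewrite !inE.
    case: (eqVneq y x) => [->|] /=; first by rewrite (negbTE xD) xA.
    by case: (y \in A) => //= _ ->.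
  apply: partitionU1 => //.
  rewrite disjoints_subset; apply/subsetP => y; rewrite !inE.
  by case/andP => _ ->.
rewrite set0U B0 setU11; split=> //.
have DE : D = (x |: D) :\: A.
  by rewrite -AE B0 setU0 setU1K.
by rewrite DE.
Qed.

Lemma del_pointK D x Q :
  x \notin D -> partition Q (x |: D) -> add_point x (del_point x Q) = Q.
Proof.
move=> xD QD; have [xA AQ AE] := partition_pblock QD.
rewrite /add_point /del_point /=; set A := pblock Q x in xA AQ AE *.
have BnQ : A :\ x \notin Q :\ A.
  apply/negP => /setD1P[BA BQ].
  have /trivIsetP/(_ _ _ BQ AQ BA) := partition_trivIset QD.
  rewrite disjoint_sym => dis; have /set0Pn[y yB] := partition_neq0 QD BQ.
  by have := disjointFl dis yB; move: yB; rewrite !inE => /andP[_ ->].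
have -> : ((if A :\ x == set0 then set0 else [set A :\ x]) :|: Q :\ A) :\ (A :\ x)
    = Q :\ A.
  by case: ifP => _; rewrite ?set0U ?setU1K // setD1id // (negbTE BnQ).
by rewrite AE setD1K.
Qed.

Lemma add_pointK D x P B : x \notin D -> partition P D -> B \in set0 |: P ->
  del_point x (add_point x (P, B)) = (P, B).
Proof.
move=> xD PD BP; have QD := partition_add_point xD PD BP.
have BD : B \subset D.
  by case/setU1P: BP => [->|]; [rewrite sub0set|exact: partitionS PD].
have xB : x \notin B by apply: contra xD; apply: (subsetP BD).
have xBP : x |: B \notin P :\ B.
  apply/negP => /setD1P[_ /(partitionS PD)/subsetP/(_ x)].
  by rewrite setU11 (negbTE xD) => /(_ isT).
have pE : pblock (add_point x (P, B)) x = x |: B.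
  by apply: def_pblock (partition_trivIset QD) _ _; rewrite ?setU11.
rewrite /del_point pE setU1K // /add_point /= setU1K //; congr pair.
case: eqVneq BP => [-> _|Bn0]; last by rewrite !inE (negbTE Bn0); exact: setD1K.
by rewrite set0U setD1id // (partition0 PD).
Qed.

Lemma card_add_point D x P B : x \notin D -> partition P D -> B \in set0 |: P ->
  #|add_point x (P, B)| = (#|P| + (B == set0))%N.
Proof.
move=> xD PD BP.
have xBP : x |: B \notin P :\ B.
  apply/negP => /setD1P[_ /(partitionS PD)/subsetP/(_ x)].
  by rewrite setU11 (negbTE xD) => /(_ isT).
rewrite /add_point cardsU1 xBP /= (cardsD1 B P).
case: eqVneq BP => [->|Bn0]; first by rewrite (partition0 PD) addnC.
by rewrite !inE (negbTE Bn0) /= => ->; rewrite addn0.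
Qed.

(** [add_point] and [del_point] are mutually inverse. The choice [B = set0] adds a block, and the
    [#|P|] choices of an existing block add none. With [F] an indicator this is the recursion for
    Stirling numbers of the second kind. *)
Lemma big_partitionU1 D x (F : nat -> nat) : x \notin D ->
  (\sum_(Q : {set {set T}} | partition Q (x |: D)) F #|Q| =
   \sum_(P : {set {set T}} | partition P D) (F #|P|.+1 + #|P| * F #|P|))%N.
Proof.
move=> xD.
rewrite (reindex_onto (add_point x) (del_point x)) /=; last first.
  by move=> Q; exact: del_pointK.
rewrite (eq_bigl (fun p => partition p.1 D && (p.2 \in set0 |: p.1))); last first.
  move=> [P B] /=; apply/andP/andP => [[QD /eqP dE]|[PD BP]].
    by have := partition_del_point xD QD; rewrite dE.
  by rewrite (add_pointK xD PD BP); split=> //; exact: partition_add_point.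
rewrite -(pair_big_dep (fun P => partition P D) (fun P B => B \in set0 |: P)
  (fun P B => F #|add_point x (P, B)|)) /=.
apply: eq_bigr => P PD; rewrite big_setU1 ?(partition0 PD) //=.
rewrite (card_add_point xD PD) ?setU11 // eqxx addn1; congr addn.
rewrite -sum_nat_const; apply: eq_bigr => B BP.
rewrite (card_add_point xD PD) ?setU1r //.
by rewrite (negbTE (partition_neq0 PD BP)) addn0.
Qed.

End StirlingSecond.

Fixpoint stirling2_rec (n k : nat) : nat :=
  match n, k with
  | 0, 0 => 1
  | 0, _.+1 => 0
  | _.+1, 0 => 0
  | n'.+1, k'.+1 => k'.+1 * stirling2_rec n' k'.+1 + stirling2_rec n' k'
  end.

Lemma card_partitions (T : finType) (D : {set T}) (k : nat) :
  #|[set P : {set {set T}} | partition P D & #|P| == k]| = stirling2_rec #|D| k.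
Proof.
have cE (E : {set T}) k' : #|[set P : {set {set T}} | partition P E & #|P| == k']|
    = (\sum_(P : {set {set T}} | partition P E) (#|P| == k'))%N.
  by rewrite -sum1dep_card big_mkcondr /=; apply: eq_bigr => P _; case: eqP.
rewrite cE; move Dn : #|D| => n; elim: n => [|n IH] in D Dn k *.
  move/eqP: Dn; rewrite cards_eq0 => /eqP ->.
  rewrite (big_pred1 set0) => [|P]; last exact: partition_set0.
  by rewrite cards0; case: k.
have [x xD] : exists x, x \in D by apply/set0Pn; rewrite -card_gt0 Dn.
have cD : #|D :\ x| = n by move: Dn; rewrite (cardsD1 x) xD => -[].
rewrite -(setD1K xD) (big_partitionU1 (fun m => (m == k : nat))) ?setD11 //.
case: k => [|k] /=.
  by rewrite big1 // => P _; case: eqP => [->|] //; rewrite muln0.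
rewrite -!(IH _ cD) big_distrr -big_split /=; apply: eq_bigr => P _.
by rewrite eqSS addnC; congr addn; case: eqP => [->|]; rewrite ?muln0.
Qed.

Lemma stirling2E n k : stirling2 n k = stirling2_rec n k.
Proof. by rewrite /stirling2 card_partitions cardsT card_ord. Qed.

(** * Sums of independent indicators *)

Lemma deriv_prod_fun (R : comNzRingType) (I : finType) (A : {set I})
    (F : I -> {poly R}) :
  (\prod_(i in A) F i)^`() = \sum_(i in A) (F i)^`() * \prod_(j in A :\ i) F j.
Proof.
move An : #|A| => n; elim: n => [|n IH] in A An *.
  move/eqP: An; rewrite cards_eq0 => /eqP ->.
  by rewrite !big_set0 derivC.
have [x xA] : exists x, x \in A by apply/set0Pn; rewrite -card_gt0 An.
have cA : #|A :\ x| = n by move: An; rewrite (cardsD1 x) xA => -[].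
rewrite (big_setD1 x) //= derivM (IH _ cA) [RHS](big_setD1 x) //=; congr (_ + _).
rewrite mulr_sumr; apply: eq_bigr => i; rewrite !inE => /andP[ix iA].
rewrite mulrCA; congr (_ * _); rewrite [RHS](big_setD1 x) /= ?inE 1?eq_sym ?ix //.
by congr (_ * _); apply: eq_bigl => j; rewrite !inE andbCA.
Qed.

(** * Ratios of consecutive probabilities for a sum of independent indicators *)

Section PoissonBinomial.
Variables (R : realFieldType) (I : finType) (pr : I -> R).
Hypothesis pr01 : forall i, 0 <= pr i <= 1.
Implicit Types (A : {set I}) (i : I) (j : nat).

(** Generating polynomial of the number of successes in independent trials with success
    probabilities [pr i], so that its coefficients are the point probabilities. *)
Definition pb_poly A : {poly R} :=
  \prod_(i in A) ((1 - pr i)%:P + (pr i)%:P * 'X).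

Definition pb_coef A j : R := (pb_poly A)`_j.

Definition pb_mean A : R := \sum_(i in A) pr i.

(* The coefficient of degree [j - 1], read as [0] when [j = 0]. *)
Definition pb_prev A j : R := ('X * pb_poly A)`_j.

Lemma pb_prevS A j : pb_prev A j.+1 = pb_coef A j.
Proof. by rewrite /pb_prev coefXM. Qed.

Lemma pb_prev0 A : pb_prev A 0 = 0.
Proof. by rewrite /pb_prev coefXM. Qed.

Lemma pb_coefD1 A i j : i \in A ->
  pb_coef A j = (1 - pr i) * pb_coef (A :\ i) j + pr i * pb_prev (A :\ i) j.
Proof.
move=> iA; rewrite /pb_coef /pb_prev /pb_poly (big_setD1 i) //= mulrDl coefD.
by rewrite coefCM -mulrA coefCM.
Qed.

Lemma pb_coef_ge0 A j : 0 <= pb_coef A j.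
Proof.
rewrite /pb_coef /pb_poly; move: j.
apply: (big_ind (fun p : {poly R} => forall j, 0 <= p`_j)).
- by move=> j; rewrite coef1; case: eqP.
- move=> p q p0 q0 j; rewrite coefM; apply: sumr_ge0 => i _.
  exact: mulr_ge0.
- move=> i _ j; have /andP[p0 p1] := pr01 i.
  rewrite coefD coefC coefCM coefX.
  case: j => [|[|j]] /=; rewrite ?mulr0 ?mulr1 ?addr0 ?add0r //.
  by rewrite subr_ge0.
Qed.

Lemma pb_prev_ge0 A j : 0 <= pb_prev A j.
Proof. by case: j => [|j]; rewrite ?pb_prev0 ?pb_prevS ?pb_coef_ge0. Qed.

(** With [j] successes in the other trials, the total is [j] or [j + 1] according to trial [i]. This
    bounds the deleted coefficient without dividing by [pr i] or [1 - pr i]. *)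
Lemma pb_coefD1_le A i j : i \in A ->
  pb_coef (A :\ i) j <= pb_coef A j + pb_coef A j.+1.
Proof.
move=> iA; rewrite (pb_coefD1 j iA) (pb_coefD1 j.+1 iA) pb_prevS.
have /andP[p0 p1] := pr01 i; have p1' : 0 <= 1 - pr i by rewrite subr_ge0.
have h1 := mulr_ge0 p0 (pb_prev_ge0 (A :\ i) j).
have h2 := mulr_ge0 p1' (pb_coef_ge0 (A :\ i) j.+1).
by lra.
Qed.

Lemma pb_prevD1_le A i j : i \in A ->
  pb_prev (A :\ i) j <= pb_prev A j + pb_coef A j.
Proof.
move=> iA; case: j => [|j]; first by rewrite !pb_prev0 add0r pb_coef_ge0.
by rewrite !pb_prevS; exact: pb_coefD1_le.
Qed.

(* The derivative of the generating polynomial gives [j p_j] as a sum over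
   one-point deletions; the linear recursion for a deleted point does the rest. *)
Lemma pb_coef_recursion A j :
  j.+1%:R * pb_coef A j.+1 - pb_mean A * pb_coef A j =
  \sum_(i in A) pr i ^+ 2 * (pb_coef (A :\ i) j - pb_prev (A :\ i) j).
Proof.
have -> : j.+1%:R * pb_coef A j.+1 = \sum_(i in A) pr i * pb_coef (A :\ i) j.
  rewrite mulr_natl /pb_coef -coef_deriv {1}/pb_poly deriv_prod_fun coef_sum.
  apply: eq_bigr => i iA.
  by rewrite derivD derivC add0r derivM derivC derivX mul0r add0r mulr1 coefCM.
rewrite /pb_mean mulr_suml -sumrB; apply: eq_bigr => i iA.
by rewrite (pb_coefD1 j iA); ring.
Qed.

Variable C : R.

(** In [pb_coef_recursion] each difference is at most [pb_coef A j + pb_coef A j.+1], and the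
    weights [pr i ^+ 2] sum to at most [C]. *)
Lemma pb_upper A j : \sum_(i in A) pr i ^+ 2 <= C ->
  (j.+1%:R - C) * pb_coef A j.+1 <= (pb_mean A + C) * pb_coef A j.
Proof.
move=> hC; have := pb_coef_recursion A j.
set S := \sum_(i in A) _ * _ => E.
have : S <= C * (pb_coef A j + pb_coef A j.+1).
  apply: (@le_trans _ _ (\sum_(i in A) pr i ^+ 2 * (pb_coef A j + pb_coef A j.+1))).
    apply: ler_sum => i iA; apply: ler_wpM2l; first exact: sqr_ge0.
    rewrite lerBlDr (le_trans (pb_coefD1_le j iA)) // lerDl.
    exact: pb_prev_ge0.
  by rewrite -mulr_suml; apply: ler_wpM2r hC; rewrite addr_ge0 ?pb_coef_ge0.
lra.
Qed.

(** Induction on [j]: the bound at the previous index, where the index is at most twice [m], shows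
    that the previous coefficient is at most twice the current one. The negative part of the
    recursion is then at most [C * (2 + 1)] times the current coefficient, whence [3 * C]. *)
Lemma pb_lower A j : \sum_(i in A) pr i ^+ 2 <= C ->
  j.+1%:R <= 2 * (pb_mean A - 3 * C) ->
  (pb_mean A - 3 * C) * pb_coef A j <= j.+1%:R * pb_coef A j.+1.
Proof.
move=> hC; have C0 : 0 <= C by apply: le_trans hC; apply: sumr_ge0 => i _; exact: sqr_ge0.
set m := pb_mean A - _.
have step l : pb_prev A l <= 2 * pb_coef A l ->
    m * pb_coef A l <= l.+1%:R * pb_coef A l.+1.
  move=> ple; have := pb_coef_recursion A l.
  set S := \sum_(i in A) _ * _ => E.
  have : - S <= C * (pb_prev A l + pb_coef A l).
    apply: (@le_trans _ _ (\sum_(i in A) pr i ^+ 2 * (pb_prev A l + pb_coef A l))).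
      rewrite -sumrN; apply: ler_sum => i iA; rewrite -mulrN.
      apply: ler_wpM2l; first exact: sqr_ge0.
      rewrite opprB lerBlDr (le_trans (pb_prevD1_le l iA)) // lerDl.
      exact: pb_coef_ge0.
    rewrite -mulr_suml; apply: ler_wpM2r hC.
    by rewrite addr_ge0 ?pb_coef_ge0 ?pb_prev_ge0.
  have := ler_wpM2l C0 ple; rewrite /m; lra.
elim: j => [|j IH] jm; apply: step.
  by rewrite pb_prev0 mulr_ge0 ?pb_coef_ge0.
have jm' : j.+1%:R <= 2 * m by apply: le_trans jm; rewrite ler_nat.
have m0 : 0 < m by have := ltr0Sn R j; lra.
rewrite pb_prevS -(ler_pM2l m0) (le_trans (IH jm')) //.
have := ler_wpM2r (pb_coef_ge0 A j.+1) jm'; lra.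
Qed.

(** The crude bounds, applied to every [A :\ i], show that two consecutive coefficients near the
    mean differ by a relative [O(1 / m)]; this is fed back into [pb_coef_recursion]. *)
Lemma pb_window A j (K : R) : \sum_(i in A) pr i ^+ 2 <= C ->
  0 <= K -> `|j.+2%:R - pb_mean A| <= K ->
  2 * (K + 1 + 3 * C) <= pb_mean A ->
  pb_mean A * `|j.+2%:R * pb_coef A j.+2 - pb_mean A * pb_coef A j.+1|
    <= C * (4 * (K + 1 + 3 * C)) * pb_coef A j.+1.
Proof.
move=> hC K0; rewrite ler_norml => /andP[jl ju]; set m := pb_mean A in jl ju * => mbig.
have C0 : 0 <= C by apply: le_trans hC; apply: sumr_ge0 => i _; exact: sqr_ge0.
have m0 : 0 <= m by lra.
rewrite pb_coef_recursion -{1}(ger0_norm m0) -normrM mulr_sumr.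
apply: le_trans (ler_norm_sum _ _ _) _.
have E0 : 0 <= 4 * (K + 1 + 3 * C) by lra.
apply: (@le_trans _ _ (\sum_(i in A)
    pr i ^+ 2 * (4 * (K + 1 + 3 * C) * pb_coef A j.+1))); last first.
  rewrite -mulr_suml -[leRHS]mulrA; apply: ler_wpM2r hC.
  by rewrite mulr_ge0 ?pb_coef_ge0.
apply: ler_sum => i iA.
rewrite mulrCA normrM ger0_norm ?sqr_ge0 //; apply: ler_wpM2l; first exact: sqr_ge0.
rewrite (pb_coefD1 j.+1 iA) pb_prevS.
have /andP[p0 p1] := pr01 i.
have mE : pb_mean (A :\ i) = m - pr i.
  by rewrite /m /pb_mean (big_setD1 i iA) /= addrAC subrr add0r.
have hC' : \sum_(l in A :\ i) pr l ^+ 2 <= C.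
  apply: le_trans hC; rewrite [leRHS](big_setD1 i iA) /= lerDr; exact: sqr_ge0.
have := pb_upper j hC'; have := @pb_lower (A :\ i) j hC'.
have := pb_coef_ge0 (A :\ i) j.+1; have := pb_coef_ge0 (A :\ i) j.
rewrite mE; set g := pb_coef _ j; set g1 := pb_coef _ j.+1 => g0 g10.
have j1E : j.+2%:R = j.+1%:R + 1 :> R by rewrite -natr1.
rewrite j1E in jl ju; set x : R := j.+1%:R in jl ju *.
have xm : x <= 2 * (m - 1 - 3 * C) by lra.
move=> low up.
(* The mean of [A :\ i] is [m - pr i], and [pr i] lies between 0 and 1. *)
have {}low : (m - 1 - 3 * C) * g <= x * g1.
  by apply: le_trans (low _); [apply: ler_wpM2r => //; lra|lra].
have {}up : (x - C) * g1 <= (m + C) * g.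
  by apply: le_trans up _; apply: ler_wpM2r => //; lra.
have gg1 : g <= 2 * g1.
  have h0 : 0 < m - 1 - 3 * C by lra.
  rewrite -(ler_pM2l h0) (le_trans low) //.
  by have := ler_wpM2r g10 xm; lra.
(* The right side is [2 * pb_coef A j.+1] split according to trial [i], so a bound in terms of [g]
   becomes one in terms of the coefficient of [A]. *)
have h1 : g <= 2 * ((1 - pr i) * g1 + pr i * g) by nra.
have K' : 0 <= 2 * (K + 1 + 3 * C) by lra.
apply: (@le_trans _ _ (2 * (K + 1 + 3 * C) * g)); last first.
  by have := ler_wpM2l K' h1; lra.
rewrite ler_norml; apply/andP; split.
  have : x * (g - g1) <= (K + 3 * C) * g by nra.
  case: (lerP g g1) => [gl|gl]; first by nra.
  (* The window and the size of [m] force [x >= m / 2], and below also [x - C >= m / 2]. *)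
  have : (m / 2) * (g - g1) <= x * (g - g1) by apply: ler_wpM2r; lra.
  have : 0 <= g * (K + 1) by rewrite mulr_ge0 //; lra.
  nra.
have : (x - C) * (g1 - g) <= (K + 1 + 2 * C) * g by nra.
case: (lerP g1 g) => [gl|gl]; first by nra.
have : (m / 2) * (g1 - g) <= (x - C) * (g1 - g) by apply: ler_wpM2r; lra.
nra.
Qed.

End PoissonBinomial.

(** * Mode of the weights [p j * b j / t ^+ j] for an almost geometric sequence [b] *)

Section ModeLocation.
Variables (R : realFieldType) (I : finType) (pr : I -> R).
Variables (C t : R) (b : nat -> R) (J : nat).
Hypotheses (pr01 : forall i, 0 <= pr i <= 1) (t_gt0 : 0 < t).
Hypothesis prC : \sum_(i in [set: I]) pr i ^+ 2 <= C.
Hypothesis b_leS : forall j, t * b j <= b j.+1.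
Hypothesis b_ratio : forall j, (J <= j)%N ->
  j.+1%:R * b j.+1 <= (j.+1%:R + 16^-1) * (t * b j).

Local Notation p := (pb_coef pr [set: I]).
Local Notation m := (pb_mean pr [set: I]).

Hypothesis m_large : 12 + 40 * C + J%:R + 32 * (C * (3 + 6 * C)) <= m.

Let C_ge0 : 0 <= C.
Proof. by apply: le_trans prC; apply: sumr_ge0 => i _; exact: sqr_ge0. Qed.

Let CC_ge0 : 0 <= C * (3 + 6 * C).
Proof. by have C0 := C_ge0; rewrite mulr_ge0 //; lra. Qed.

Let p_ge0 j : 0 <= p j.
Proof. exact: pb_coef_ge0. Qed.

(** The radius [3 * C + 2] covers every index that the crude bounds leave open. For this radius the
    error in [pb_window] is [4 * C * (3 + 6 * C) / m], which the last summand in [m_large] makes at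
    most 1/8. *)
Lemma pb_window_eighth j : `|j.+1%:R - m| <= 3 * C + 2 ->
  `|j.+1%:R * p j.+1 - m * p j| <= 8^-1 * p j.
Proof.
have J0 := ler0n R J; have C0 := C_ge0; have CC0 := CC_ge0; have mL := m_large.
case: j => [|j] jm.
  by move: jm; rewrite ler_norml => /andP[]; lra.
have := pb_window pr01 prC _ jm _.
have K0 : 0 <= 3 * C + 2 by lra.
have mK : 2 * (3 * C + 2 + 1 + 3 * C) <= m by lra.
move=> /(_ K0 mK); have m0 : 0 < m by lra.
rewrite -ler_pdivlMl // => /le_trans; apply.
rewrite [leLHS]mulrA; apply: ler_wpM2r => //.
rewrite ler_pdivrMl //; lra.
Qed.

(** By contradiction: [pb_upper] excludes [i + 1 >= m + 3 * C + 1]; closer to [m] the window error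
    1/8 and the loss 1/16 from [b_ratio] add up to less than 1/4. *)
Lemma mode_upper i : 0 < p i.+1 -> 0 < b i.+1 ->
  p i * (t * b i) <= p i.+1 * b i.+1 -> i.+1%:R < m + 4^-1.
Proof.
move=> pi0 bi0 le_w; rewrite ltNge; apply/negP => mi.
have J0 := ler0n R J; have C0 := C_ge0; have CC0 := CC_ge0; have mL := m_large.
have i1E : i.+1%:R = i%:R + 1 :> R by rewrite -natr1.
have Ji : (J <= i)%N by rewrite -(ler_nat R); lra.
have i0 : 0 < i.+1%:R :> R by rewrite ltr0n.
have w0 : 0 < p i.+1 * b i.+1 by rewrite mulr_gt0.
(* Passing from [p] to the weights costs the factor [1 + 1 / (16 * (i + 1))]; since [d <= i + 1],
   this raises [d] by at most 1/16. *)
have key (c d : R) : 0 <= d -> d <= i.+1%:R ->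
    c * p i.+1 <= d * p i -> c <= d + 16^-1.
  move=> d0 di cd.
  have h1 : c * p i.+1 * (i.+1%:R * b i.+1) <= d * p i * (i.+1%:R * b i.+1).
    by apply: ler_wpM2r cd; rewrite mulr_ge0 ?ltW.
  have h2 : d * p i * (i.+1%:R * b i.+1) <=
      d * p i * ((i.+1%:R + 16^-1) * (t * b i)).
    by apply: ler_wpM2l (b_ratio Ji); rewrite mulr_ge0.
  have h3 : d * (i.+1%:R + 16^-1) * (p i * (t * b i)) <=
      d * (i.+1%:R + 16^-1) * (p i.+1 * b i.+1).
    by apply: ler_wpM2l le_w; rewrite mulr_ge0 //; lra.
  have h4 : c * i.+1%:R * (p i.+1 * b i.+1) <=
      d * (i.+1%:R + 16^-1) * (p i.+1 * b i.+1) by lra.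
  rewrite ler_pM2r // in h4.
  rewrite -(ler_pM2r i0); lra.
have [far|near] := leP (m + 3 * C + 1) i.+1%:R.
  have := key (i.+1%:R - C) (m + C) _ _ (pb_upper pr01 i prC).
  by move=> /(_ ltac:(lra) ltac:(lra)); lra.
have win : `|i.+1%:R - m| <= 3 * C + 2 by rewrite ler_norml; lra.
have := pb_window_eighth win; rewrite ler_norml => /andP[_ up].
have up' : i.+1%:R * p i.+1 <= (m + 8^-1) * p i by lra.
have := key _ _ _ _ up'; move=> /(_ ltac:(lra) ltac:(lra)); lra.
Qed.

(** As [b] grows at least by the factor [t], the comparison descends to [p i.+1 <= p i]. Then
    [pb_lower] places [i + 1] in the window, where an error of 1/8 contradicts a gap of 1/4. *)
Lemma mode_lower i : 0 < p i -> 0 < b i ->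
  p i.+1 * b i.+1 <= p i * (t * b i) -> m - 4^-1 < i.+1%:R.
Proof.
move=> pi0 bi0 le_w; rewrite ltNge; apply/negP => mi.
have J0 := ler0n R J; have C0 := C_ge0; have CC0 := CC_ge0; have mL := m_large.
have pS : p i.+1 <= p i.
  have tb0 : 0 < t * b i by rewrite mulr_gt0.
  rewrite -(ler_pM2r tb0); apply: le_trans le_w.
  by apply: ler_wpM2l (b_leS i).
have i0 : 0 <= i.+1%:R :> R by [].
have pS' : i.+1%:R * p i.+1 <= i.+1%:R * p i by apply: ler_wpM2l.
have lo1 : m - 3 * C <= i.+1%:R.
  have im : i.+1%:R <= 2 * (m - 3 * C) by lra.
  have := le_trans (pb_lower pr01 prC im) pS'.
  by rewrite ler_pM2r.
have win : `|i.+1%:R - m| <= 3 * C + 2 by rewrite ler_norml; lra.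
have := pb_window_eighth win; rewrite ler_norml => /andP[lo _].
have : (m - 8^-1) * p i <= i.+1%:R * p i by lra.
rewrite ler_pM2r //; lra.
Qed.

End ModeLocation.

(* Imported only here: mathcomp-classical shadows the finite-set notations. *)
From mathcomp Require Import all_classical all_reals all_analysis.
From mathcomp Require Import measurable_realfun.
Import numFieldNormedType.Exports.

(** * The Gamma function *)

Section GammaFunction.
Local Open Scope classical_set_scope.
Variable R : realType.
Implicit Types (x y h t : R).
Notation mu := (@lebesgue_measure R).

Definition gamma_fun y t : R := t `^ (y - 1) * expR (- t).

(** The extended-real value lets the functional equation be proved first and then be used to derive
    finiteness. *)
Definition eGamma y : \bar R := (\int[mu]_(t in `]0%R, +oo[) (gamma_fun y t)%:E)%E.

Lemma gamma_fun_ge0 y t : 0 <= gamma_fun y t.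
Proof. by rewrite mulr_ge0 ?powR_ge0 ?expR_ge0. Qed.

Lemma measurable_gamma_fun (D : set R) y : measurable_fun D (gamma_fun y).
Proof.
apply: measurable_funTS; apply: measurable_funM; first exact: measurable_powR.
by apply: measurableT_comp => //; exact: measurable_expR.
Qed.

Lemma emeasurable_gamma_fun (D : set R) y :
  measurable_fun D (fun t => (gamma_fun y t)%:E).
Proof. by apply/measurable_EFinP; exact: measurable_gamma_fun. Qed.

Lemma eGamma_ge0 y : (0 <= eGamma y)%E.
Proof. by apply: integral_ge0 => t _; rewrite lee_fin gamma_fun_ge0. Qed.

(** Compact intervals exhausting the positive half-line; the right end [n + 2] keeps the one for
    [n = 0] nondegenerate. *)
Definition trunc_itv (n : nat) : set R := `[n.+1%:R^-1, n.+2%:R].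

Lemma cvg_trunc_eGamma y :
  (\int[mu]_(t in trunc_itv n) (gamma_fun y t)%:E)%E @[n --> \oo] --> eGamma y.
Proof.
have -> : eGamma y =
    (\int[mu]_(t in \bigcup_n trunc_itv n) (gamma_fun y t)%:E)%E.
  rewrite /eGamma; congr (integral _ _ _); apply/seteqP; split => t /=.
    rewrite in_itv/= andbT => t0.
    pose n := (Num.truncn (Num.max t t^-1)).+1.
    have nt : Num.max t t^-1 < n%:R by exact: truncnS_gt.
    have /andP[nt1 nt2] : (t < n%:R) && (t^-1 < n%:R) by rewrite -gt_max.
    exists n => //; rewrite /trunc_itv /= in_itv /=; apply/andP; split.
      rewrite -[leRHS]invrK lef_pV2 ?posrE ?invr_gt0 ?ltr0Sn //.
      by rewrite (le_trans (ltW nt2)) // ler_nat.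
    by rewrite (le_trans (ltW nt1)) // ler_nat ltnW.
  move=> [n _]; rewrite /trunc_itv /= !in_itv /= andbT => /andP[+ _].
  by apply: lt_le_trans; rewrite invr_gt0 ltr0Sn.
apply: ge0_nondecreasing_set_cvg_integral.
- apply/nondecreasing_seqP => n; apply/subsetPset; apply: subset_itvScc.
    by rewrite bnd_simp lef_pV2 ?posrE ?ltr0Sn // ler_nat.
  by rewrite bnd_simp ler_nat.
- by move=> n; exact: measurable_itv.
- by move=> n; exact: emeasurable_gamma_fun.
- by move=> n t _; rewrite lee_fin gamma_fun_ge0.
Qed.

Lemma derivable_pos_LRcontinuous (F : R -> R) a b :
  (forall x, 0 < x -> derivable F x 1) -> 0 < a -> a < b ->
  derivable_oo_LRcontinuous F a b.
Proof.
move=> dF a0 ab.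
have cF x : 0 < x -> {for x, continuous F}.
  by move=> x0; apply: differentiable_continuous; exact/derivable1_diffP/dF.
split.
- by move=> x; rewrite in_itv/= => /andP[ax _]; apply: dF; exact: lt_trans ax.
- exact/cvg_at_right_filter/cF.
- exact/cvg_at_left_filter/cF/(lt_trans a0).
Qed.

Lemma derivable_pos_within (F : R -> R) a b :
  (forall x, 0 < x -> derivable F x 1) -> 0 < a ->
  {within `[a, b], continuous F}.
Proof.
move=> dF a0; apply: derivable_within_continuous => x.
by rewrite in_itv/= => /andP[ax _]; apply: dF; exact: lt_le_trans ax.
Qed.

Lemma is_derive_NexpRN x : is_derive x 1 (fun t => - expR (- t)) (expR (- x)).
Proof. by apply: is_derive_eq; rewrite mulrN1 opprK. Qed.

Lemma derivable_powR_pos y x : 0 < x -> derivable (fun t : R => t `^ y) x 1.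
Proof. by move=> x0; apply: derivable_powR; rewrite in_itv/= andbT. Qed.

(** Integration by parts with the primitive [- expR (- t)], on an interval away from 0 where real
    powers are differentiable. *)
Lemma trunc_gamma_parts y n :
  (\int[mu]_(t in trunc_itv n) (gamma_fun (y + 1) t)%:E =
  (gamma_fun (y + 1) n.+1%:R^-1 - gamma_fun (y + 1) n.+2%:R)%:E
  + y%:E * \int[mu]_(t in trunc_itv n) (gamma_fun y t)%:E)%E.
Proof.
have a0 : 0 < n.+1%:R^-1 :> R by rewrite invr_gt0 ltr0Sn.
have ab : n.+1%:R^-1 < n.+2%:R :> R.
  by rewrite (@le_lt_trans _ _ 1) ?ltr1n // invf_le1 ?ltr0Sn // ler1n.
rewrite (@eq_integral _ _ _ mu (trunc_itv n)
  (fun t => (t `^ y * expR (- t))%:E)); last first.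
  by move=> t _; rewrite /gamma_fun addrK.
rewrite (@integration_by_parts R (fun t : R => t `^ y) (fun t => - expR (- t))
  (fun t => y * t `^ (y - 1)) (fun t => expR (- t))) //.
- congr (_ + _)%E.
    by rewrite /gamma_fun addrK !mulrN opprK addrC.
  have gi : mu.-integrable (trunc_itv n) (EFin \o gamma_fun y).
    apply: continuous_compact_integrable; first exact: segment_compact.
    apply: derivable_pos_within => // x x0; apply: derivableM => //.
    exact: derivable_powR_pos.
  have iZ : (\int[mu]_(t in trunc_itv n) ((- y)%:E * (gamma_fun y t)%:E) =
      (- y)%:E * \int[mu]_(t in trunc_itv n) (gamma_fun y t)%:E)%E.
    by apply: integralZl gi _; exact: measurable_itv.
  have yE : y%:E = (- (- y)%:E)%E by rewrite EFinN oppeK.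
  rewrite [in RHS]yE mulNe -iZ; congr (- _)%E.
  by apply: eq_integral => t _; rewrite -EFinM /= /gamma_fun; congr EFin; ring.
- apply: derivable_pos_within => // x x0; apply: derivableM => //.
  exact: derivable_powR_pos.
- by apply: derivable_pos_LRcontinuous => // x x0; exact: derivable_powR_pos.
- move=> x; rewrite in_itv/= => /andP[ax _]; rewrite powR_derive1 //.
  by rewrite in_itv/= andbT (lt_trans a0).
- exact: derivable_pos_within.
- apply: derivable_pos_LRcontinuous => // x x0.
- move=> x _; rewrite derive1E; have [_ ->] := is_derive_NexpRN x; by [].
Qed.

(** For an integer [m >= y - 1], the bound [expR x >= x ^+ m.+1 / m.+1!] gives the majorant
    [m.+1! / x] for [x >= 1]. *)
Lemma gamma_fun_cvgy y : gamma_fun y x @[x --> +oo] --> 0.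
Proof.
pose m := (Num.truncn `|y - 1|).+1.
have ym : y - 1 <= m%:R.
  by apply: le_trans (ler_norm _) _; apply/ltW/truncnS_gt.
apply: (@squeeze_cvgr _ _ _ _ (fun=> 0) (fun x : R => m.+1`!%:R / x)).
- near=> x; rewrite gamma_fun_ge0 /=.
  have x1 : 1 <= x by near: x; apply: nbhs_pinfty_ge; rewrite num_real.
  have x0 : 0 < x by exact: lt_le_trans x1.
  rewrite /gamma_fun expRN ler_pdivrMr ?expR_gt0 // mulrAC ler_pdivlMr //.
  rewrite (@le_trans _ _ (x ^+ m * x)) //.
    by rewrite ler_pM2r // -powR_mulrn; [exact: ler_powR|exact: ltW].
  rewrite -exprSr -ler_pdivrMl ?ltr0n ?fact_gt0 //.
  rewrite mulrC; apply: le_trans (expR_ge1Dxn m _); last exact: ltW.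
  by rewrite lerDr.
- exact: cvg_cst.
- rewrite -(mulr0 (m.+1`!%:R : R)); apply: cvgMr.
  apply/gtr0_cvgV0 => //; near=> x; near: x; exact: nbhs_pinfty_gt.
Unshelve. all: by end_near. Qed.

Lemma gamma_fun_cvg0 y : 0 < y -> gamma_fun (y + 1) x @[x --> 0^'+] --> 0.
Proof.
move=> y0; rewrite -[X in _ --> X](mul0r (expR (- 0))).
rewrite /gamma_fun; apply: cvgM; first by rewrite addrK; exact: powR_cvg0.
apply: cvg_at_right_filter; apply: continuous_comp; first exact: continuousN.
exact: continuous_expR.
Qed.

(** Limit of the truncated integration by parts; both boundary terms tend to 0. *)
Lemma eGammaS y : 0 < y -> eGamma (y + 1) = (y%:E * eGamma y)%E.
Proof.
move=> y0.
rewrite -(cvg_lim (@ereal_hausdorff R) (@cvg_trunc_eGamma (y + 1))).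
apply/cvg_lim; first exact: ereal_hausdorff.
rewrite (eq_cvg _ _ (trunc_gamma_parts y)) -(add0e (y%:E * eGamma y)%E).
apply: cvgeD => //.
- apply: cvg_EFin; first exact: nearW.
  rewrite -(subr0 (0 : R)); apply: cvgB.
    have := gamma_fun_cvg0 y0; move/cvg_at_rightP; apply; split.
      by move=> n; rewrite invr_gt0 ltr0Sn.
    exact: cvg_harmonic.
  have /cvg_pinftyP := gamma_fun_cvgy (y + 1); apply.
  apply/cvgryPge => A; near=> n; rewrite (@le_trans _ _ n%:R) ?ler_nat //.
    by near: n; exact: nbhs_infty_ger.
  by rewrite ltnW.
- apply: cvgeZl => //; exact: cvg_trunc_eGamma.
Unshelve. all: by end_near. Qed.


Lemma eGamma1 : eGamma 1 = 1%E.
Proof.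
rewrite /eGamma integral_itv_obnd_cbnd; last exact: emeasurable_gamma_fun.
under eq_integral do rewrite /gamma_fun subrr powRr0 mul1r.
rewrite (@ge0_continuous_FTC2y R _ (fun t => - expR (- t)) _ 0).
- by rewrite oppr0 expR0 EFinN oppeK add0e.
- by move=> x _; exact: expR_ge0.
- apply: continuous_subspaceT => x; apply: continuous_comp; first exact: continuousN.
  exact: continuous_expR.
- by rewrite -oppr0; apply: cvgN; exact: cvgr_expR.
- by move=> x _; have [] := is_derive_NexpRN x.
- apply: cvg_at_right_filter; apply: cvgN; apply: continuous_comp.
    exact: continuousN.
  exact: continuous_expR.
- by move=> x _; rewrite derive1E; have [_ ->] := is_derive_NexpRN x.
Qed.

Lemma eGamma_nat_lty n : (eGamma n.+1%:R < +oo)%E.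
Proof.
elim: n => [|n IH]; first by rewrite eGamma1 ltry.
rewrite -natr1 eGammaS ?ltr0Sn // lte_mul_pinfty // ?lee_fin ?ler0n //.
Qed.

(** For [z >= 1] the integrand is dominated through [t ^ (z - 1) <= 1 + t ^ n], hence by the
    integrals at 1 and [n + 1]. Any positive [y] reduces to [y + 1] by the functional equation,
    since a positive multiple of [+oo] is [+oo]. *)
Lemma eGamma_lty y : 0 < y -> (eGamma y < +oo)%E.
Proof.
have ge1 z : 1 <= z -> (eGamma z < +oo)%E.
  move=> z1; pose n := (Num.truncn z).+1.
  have zn : z - 1 <= n%:R.
    by apply: (@le_trans _ _ z); [lra|exact/ltW/truncnS_gt].
  apply: (@le_lt_trans _ _ (eGamma 1 + eGamma n.+1%:R)%E); last first.
    apply: lte_add_pinfty; last exact: (eGamma_nat_lty n).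
    by rewrite eGamma1 ltry.
  rewrite /eGamma -ge0_integralD //=; last 4 first.
  - by move=> t _; rewrite lee_fin gamma_fun_ge0.
  - exact: emeasurable_gamma_fun.
  - by move=> t _; rewrite lee_fin gamma_fun_ge0.
  - exact: emeasurable_gamma_fun.
  apply: ge0_le_integral => //=.
  - by move=> t _; rewrite lee_fin gamma_fun_ge0.
  - exact: emeasurable_gamma_fun.
  - by apply: emeasurable_funD; exact: emeasurable_gamma_fun.
  move=> t; rewrite /= in_itv /= andbT => t0; rewrite -EFinD lee_fin /gamma_fun.
  rewrite -mulrDl ler_pM2r ?expR_gt0 // subrr powRr0.
  have -> : n.+1%:R - 1 = n%:R :> R by rewrite -natr1 addrK.
  have [t1|t1] := leP t 1.
    apply: (@le_trans _ _ 1); last by rewrite lerDl powR_ge0.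
    by rewrite -[leRHS](powRr0 t); apply: ger_powR; rewrite ?t0 // subr_ge0.
  apply: (@le_trans _ _ (t `^ n%:R)); last by rewrite lerDr.
  by apply: ler_powR => //; exact: ltW.
move=> y0; have := ge1 (y + 1); rewrite eGammaS // => /(_ _).
move: (eGamma_ge0 y); case: (eGamma y) => [g _ _|_ |]; rewrite ?ltry //.
by rewrite gt0_muley ?lte_fin // => h; have := h _; rewrite ltxx => -> //; lra.
Qed.

Lemma GammaE y : 0 < y -> (Gamma y)%:E = eGamma y.
Proof.
move=> y0; rewrite /Gamma /Rintegral fineK //.
by rewrite ge0_fin_numE ?eGamma_lty // eGamma_ge0.
Qed.

Lemma GammaS y : 0 < y -> Gamma (y + 1) = y * Gamma y.
Proof.
move=> y0; have y10 : 0 < y + 1 by rewrite addr_gt0.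
by apply: EFin_inj; rewrite EFinM !GammaE // eGammaS.
Qed.

Lemma Gamma1 : Gamma (1 : R) = 1.
Proof. by apply: EFin_inj; rewrite GammaE ?ltr01 // eGamma1. Qed.

(** Weighted arithmetic-geometric mean inequality for [x] and 1, from concavity of [ln]. *)
Lemma powR_le_chord x h : 0 < x -> 0 <= h <= 1 -> x `^ h <= 1 - h + h * x.
Proof.
move=> x0 /andP[h0 h1].
have := @concave_ln R (Itv01 h0 h1) x 1 x0 ltr01.
rewrite !convRE /= /unstable.onem ln1 mulr0 addr0 mulr1 => lnh.
have c0 : 0 < h * x + (1 - h) by nra.
rewrite addrC -ler_ln ?posrE ?powR_gt0 // ln_powR.
exact: lnh.
Qed.

(** The chord inequality at [t / y], multiplied by [y ^ h] and integrated against the integrand for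
    [y]; [Gamma (y + 1) = y * Gamma y] then collapses the two terms on the right. *)
Lemma Gamma_wendel y h : 0 < y -> 0 <= h <= 1 ->
  Gamma (y + h) <= y `^ h * Gamma y.
Proof.
move=> y0 h01; have /andP[h0 h1] := h01.
have yh0 : 0 < y + h by rewrite ltr_wpDr.
have y10 : 0 < y + 1 by rewrite addr_gt0.
have c0 : 0 <= y `^ h * (1 - h) by rewrite mulr_ge0 ?powR_ge0 // subr_ge0.
have d0 : 0 <= y `^ h * (h / y) by rewrite mulr_ge0 ?powR_ge0 // divr_ge0 // ltW.
suff : (eGamma (y + h) <= (y `^ h * (1 - h))%:E * eGamma y +
                       (y `^ h * (h / y))%:E * eGamma (y + 1))%E.
  rewrite -!GammaE // -!EFinM -EFinD lee_fin GammaS // => /le_trans; apply.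
  rewrite le_eqVlt; apply/orP; left; apply/eqP; field; exact: lt0r_neq0.
rewrite /eGamma -!ge0_integralZl_EFin //=; last 4 first.
- by move=> t _; rewrite lee_fin gamma_fun_ge0.
- exact: emeasurable_gamma_fun.
- by move=> t _; rewrite lee_fin gamma_fun_ge0.
- exact: emeasurable_gamma_fun.
have mZ (z k : R) : measurable_fun (`]0%R, +oo[ : set R)
    (fun t => k%:E * (gamma_fun z t)%:E)%E.
  by apply: measurable_funeM; exact: emeasurable_gamma_fun.
rewrite -ge0_integralD //=; last 4 first.
- by move=> t _; rewrite -EFinM lee_fin; apply: mulr_ge0 => //; exact: gamma_fun_ge0.
- exact: mZ.
- by move=> t _; rewrite -EFinM lee_fin; apply: mulr_ge0 => //; exact: gamma_fun_ge0.
- exact: mZ.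
apply: ge0_le_integral => //=.
- by move=> t _; rewrite lee_fin gamma_fun_ge0.
- exact: emeasurable_gamma_fun.
- by apply: emeasurable_funD; exact: mZ.
move=> t; rewrite /= in_itv /= andbT => t0.
rewrite -!EFinM -EFinD lee_fin /gamma_fun.
have tn0 : t != 0 by exact: lt0r_neq0.
have -> : t `^ (y + h - 1) = t `^ (y - 1) * t `^ h.
  by rewrite -powRD ?tn0 ?implybT //; congr (_ `^ _); ring.
have -> : t `^ (y + 1 - 1) = t `^ (y - 1) * t.
  by rewrite -{3}(powRr1 (ltW t0)) -powRD ?tn0 ?implybT //; congr (_ `^ _); ring.
have tyE : t `^ h = y `^ h * (t / y) `^ h.
  rewrite -powRM ?divr_ge0 ?ltW // mulrC divfK //; exact: lt0r_neq0.
have := @powR_le_chord (t / y) h (divr_gt0 t0 y0) h01.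
move=> /(ler_wpM2l (powR_ge0 y h)); rewrite -tyE => chord.
have w0 : 0 <= t `^ (y - 1) * expR (- t) by rewrite mulr_ge0 ?powR_ge0 ?expR_ge0.
have := ler_wpM2l w0 chord; lra.
Qed.

(** On []0, 1]] Wendel's inequality with [h = 1 - y] bounds [Gamma 1 = 1] by a positive multiple of
    [Gamma y]; the functional equation carries positivity upwards. *)
Lemma Gamma_gt0 y : 0 < y -> 0 < Gamma y.
Proof.
have : y <= (Num.truncn y).+1%:R by exact/ltW/truncnS_gt.
move: (Num.truncn y) => n; elim: n y => [|n IH] y.
  move=> y1 y0; have := @Gamma_wendel y (1 - y) y0.
  have -> : y + (1 - y) = 1 by ring.
  rewrite Gamma1 => /(_ _) /(lt_le_trans ltr01) h.
  have : 0 < y `^ (1 - y) * Gamma y by apply: h; lra.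
  by rewrite pmulr_rgt0 // powR_gt0.
move=> yn y0; have [y1|y1] := leP y 1.
  by apply: IH => //; rewrite (le_trans y1) // ler1n.
have y10 : 0 < y - 1 by rewrite subr_gt0.
rewrite -(subrK 1 y) GammaS // mulr_gt0 // IH //.
by rewrite lerBlDr natr1.
Qed.


End GammaFunction.

(** * Differentiability of [ln Gamma] and the digamma limit *)

Section LnGamma.
Local Open Scope classical_set_scope.
Variable R : realType.
Implicit Types (x y h t : R).

Lemma ln_diff_le (a b : R) : 0 < a -> 0 < b -> ln b - ln a <= (b - a) / a.
Proof.
move=> a0 b0; rewrite -ln_div ?posrE //.
have -> : b / a = 1 + (b - a) / a by field; exact: lt0r_neq0.
apply: le_ln1Dx; rewrite mulrBl divff ?lt0r_neq0 //.
by rewrite ltrBrDr addrC subrr divr_gt0.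
Qed.

(* [g] stands for [ln \o Gamma]. The functional equation and Wendel's inequality
   pin the difference quotients of [g] at [x + n] to [ln (x + n)] up to [O(1/n)],
   so [g] is differentiable without differentiating under the integral sign. *)
Section GammaLike.
Variable g : R -> R.
Hypothesis gS : forall y, 0 < y -> g (y + 1) = ln y + g y.
Hypothesis g_up : forall y h, 0 < y -> 0 <= h <= 1 -> g (y + h) <= h * ln y + g y.

Lemma loggammaDn y n : 0 < y ->
  g (y + n%:R) = \sum_(i < n) ln (y + i%:R) + g y.
Proof.
move=> y0; elim: n => [|n IH]; first by rewrite addr0 big_ord0 add0r.
rewrite -natr1 addrA gS ?ltr_wpDr // IH big_ord_recr /=; ring.
Qed.

(** The lower bound is Wendel's inequality for the complementary step from [y + h] to [y + 1]. *)
Lemma loggamma_wendel y h : 0 < y -> 0 <= h <= 1 ->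
  h * ln y - h / y <= g (y + h) - g y <= h * ln y.
Proof.
move=> y0 h01; have /andP[h0 h1] := h01.
have yh0 : 0 < y + h by rewrite ltr_wpDr.
apply/andP; split; last by have := g_up y0 h01; lra.
have h01' : 0 <= 1 - h <= 1 by lra.
have := g_up yh0 h01'; have -> : y + h + (1 - h) = y + 1 by ring.
rewrite gS // => up'.
have le1 : ln y <= ln (y + h) by rewrite ler_ln ?posrE // lerDl.
have := ln_diff_le y0 yh0; have -> : y + h - y = h by ring.
have := ler_wpM2l h0 le1.
move: (ln y) (ln (y + h)) (g y) (g (y + h)) up' => a b c d; move: (h / y) => e; lra.
Qed.

(** For negative [h] the base point becomes [y + h >= y - 1]; replacing [ln (y + h)] by [ln y] costs
    a second term of the same size, whence the factor 2. *)
Lemma loggamma_increment y h : 2 <= y -> `|h| <= 1 ->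
  `|g (y + h) - g y - h * ln y| <= `|h| * (2 / (y - 1)).
Proof.
move=> y2 h1; have y0 : 0 < y by lra.
have y10 : 0 < y - 1 by lra.
have iy : y^-1 <= (y - 1)^-1 by rewrite lef_pV2 ?posrE //; lra.
have iy0 : 0 < (y - 1)^-1 by rewrite invr_gt0.
have [h0|h0] := leP 0 h.
  rewrite (ger0_norm h0) in h1 *.
  have h01 : 0 <= h <= 1 by lra.
  have /andP[] := loggamma_wendel y0 h01.
  have := ler_wpM2l h0 iy => a b c; rewrite ler_norml; nra.
rewrite (ltr0_norm h0) in h1 *.
have yh0 : 0 < y + h by lra.
have h01 : 0 <= - h <= 1 by lra.
have := loggamma_wendel yh0 h01.
rewrite addrK => /andP[lo up].
have le1 : ln (y + h) <= ln y by rewrite ler_ln ?posrE //; lra.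
have := ln_diff_le yh0 y0; have -> : y - (y + h) = - h by ring.
have ih : (y + h)^-1 <= (y - 1)^-1 by rewrite lef_pV2 ?posrE //; lra.
have nh0 : 0 <= - h by lra.
have ih' := ler_wpM2l nh0 ih.
have l1 := ler_wpM2l nh0 le1.
move=> dl; have dl2 : ln y - ln (y + h) <= (y - 1)^-1 by nra.
have := ler_wpM2l nh0 dl2.
rewrite ler_norml; lra.
Qed.

Definition invsum x n : R := \sum_(i < n) (x + i%:R)^-1.

(** Telescoping; the induction carries the sharper bound with [- (x + n%:R)^-1]. *)
Lemma sum_inv_sqr_le x n : 0 < x ->
  \sum_(i < n) (x + i%:R) ^- 2 <= x ^- 2 + x^-1.
Proof.
move=> x0; suff : \sum_(i < n.+1) (x + i%:R) ^- 2 <= x ^- 2 + x^-1 - (x + n%:R)^-1.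
  have xn0 : 0 < x + n%:R by rewrite ltr_wpDr.
  move=> h; have : 0 <= (x + n%:R)^-1 by rewrite invr_ge0 ltW.
  have : 0 <= (x + n%:R) ^- 2 by rewrite invr_ge0 exprn_ge0 // ltW.
  by move: h; rewrite big_ord_recr /=; lra.
elim: n => [|n IH]; first by rewrite big_ord1 addr0; lra.
rewrite big_ord_recr /= (le_trans (lerD IH (lexx _))) //.
have xn0 : 0 < x + n%:R by rewrite ltr_wpDr.
rewrite -natr1 addrA; set a := x + n%:R in xn0 *.
have a1 : 0 < a + 1 by lra.
have : (a + 1) ^- 2 <= a^-1 - (a + 1)^-1; last by lra.
have -> : a^-1 - (a + 1)^-1 = (a * (a + 1))^-1 by field; rewrite !lt0r_neq0.
by rewrite lef_pV2 ?posrE ?exprn_gt0 ?mulr_gt0 // expr2 ler_pM2r //; lra.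
Qed.

(** The tangents of [ln] at [a] and at [a + h] enclose the increment, and [a + h >= a / 2] bounds
    the difference of their slopes. *)
Lemma ln_increment_le a h : 0 < a -> `|h| <= a / 2 ->
  `|ln (a + h) - ln a - h / a| <= 2 * h ^+ 2 * a ^- 2.
Proof.
move=> a0; rewrite ler_norml => /andP[h1 h2]; have ah0 : 0 < a + h by lra.
have := ln_diff_le a0 ah0; have -> : a + h - a = h by ring.
have := ln_diff_le ah0 a0; have -> : a - (a + h) = - h by ring.
move=> lo up; rewrite ler_norml.
have q0 : 0 <= 2 * h ^+ 2 * a ^- 2.
  by rewrite mulr_ge0 ?invr_ge0 ?sqr_ge0 // mulr_ge0 ?sqr_ge0.
have : h / a - h / (a + h) <= 2 * h ^+ 2 * a ^- 2; last by lra.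
have -> : h / a - h / (a + h) = h ^+ 2 * (a * (a + h))^-1.
  by field; rewrite !lt0r_neq0.
have -> : 2 * h ^+ 2 * a ^- 2 = h ^+ 2 * (a ^+ 2 / 2)^-1.
  by field; exact: lt0r_neq0.
apply: ler_wpM2l; first exact: sqr_ge0.
by rewrite lef_pV2 ?posrE ?mulr_gt0 ?divr_gt0 ?exprn_gt0 //; nra.
Qed.

(** The functional equation moves the increment from [x] to [x + n] at the price of [n] increments
    of [ln]. Linearizing these leaves a quadratic error in [h] that is uniform in [n]. *)
Lemma loggamma_diff x h n : 0 < x -> `|h| <= 1 -> `|h| <= x / 2 -> 2 <= x + n%:R ->
  `|g (x + h) - g x - h * (ln (x + n%:R) - invsum x n)|
    <= `|h| * (2 / (x + n%:R - 1)) + 2 * h ^+ 2 * (x ^- 2 + x^-1).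
Proof.
move=> x0 h1 hx xn.
have xh0 : 0 < x + h by move: hx; rewrite ler_norml => /andP[]; lra.
have := loggammaDn n xh0; have := loggammaDn n x0.
have -> : x + h + n%:R = x + n%:R + h by ring.
move=> E1 E2.
have -> : g (x + h) - g x - h * (ln (x + n%:R) - invsum x n) =
  (g (x + n%:R + h) - g (x + n%:R) - h * ln (x + n%:R))
  - \sum_(i < n) (ln (x + i%:R + h) - ln (x + i%:R) - h / (x + i%:R)).
  rewrite E1 E2 !sumrB -mulr_sumr -/(invsum x n).
  rewrite (eq_bigr (fun i : 'I_n => ln (x + i%:R + h))); last first.
    by move=> i _; congr ln; ring.
  ring.
apply: le_trans (ler_normB _ _) _; apply: lerD; first exact: loggamma_increment.
apply: le_trans (ler_norm_sum _ _ _) _.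
have q0 : 0 <= 2 * h ^+ 2 by rewrite mulr_ge0 ?sqr_ge0.
apply: le_trans _ (ler_wpM2l q0 (sum_inv_sqr_le n x0)).
rewrite mulr_sumr; apply: ler_sum => i _; apply: ln_increment_le.
  by rewrite ltr_wpDr.
by have := ler0n R i; lra.
Qed.

Definition digamma_seq x n : R := ln (x + n%:R) - invsum x n.

Lemma digamma_seq_nonincreasing x : 0 < x ->
  {homo digamma_seq x : m n / (m <= n)%N >-> n <= m}.
Proof.
move=> x0; apply/nonincreasing_seqP => n.
have xn0 : 0 < x + n%:R by rewrite ltr_wpDr.
have xn1 : 0 < x + n%:R + 1 by rewrite addr_gt0.
rewrite /digamma_seq /invsum big_ord_recr /= -natr1 addrA.
have := ln_diff_le xn0 xn1; have -> : x + n%:R + 1 - (x + n%:R) = 1 by ring.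
rewrite div1r; move: (ln _) (ln _) (\sum_(i < n) _) (_^-1) => a b c d; lra.
Qed.

(** The sequence is nonincreasing, and a single increment of [g] bounds it from below. *)
Lemma digamma_seq_cvg x : 0 < x -> cvgn (digamma_seq x).
Proof.
move=> x0; apply: nonincreasing_is_cvgn; first exact: digamma_seq_nonincreasing.
pose h := Num.min 1 (x / 2).
have h0 : 0 < h by rewrite lt_min ltr01 divr_gt0.
have h1 : `|h| <= 1 by rewrite gtr0_norm // ge_min lexx.
have hx : `|h| <= x / 2 by rewrite gtr0_norm // ge_min lexx orbT.
(* This is [loggamma_diff] for a fixed [h > 0] solved for [digamma_seq]; the index is raised to
   [n + 2] below so that its first error term is at most [2 * h]. *)
exists ((g (x + h) - g x - (2 * h + 2 * h ^+ 2 * (x ^- 2 + x^-1))) / h).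
move=> _ [n _ <-]; apply: (@le_trans _ _ (digamma_seq x n.+2)); last first.
  by apply: digamma_seq_nonincreasing => //; rewrite ltnW.
have n0 := ler0n R n; have n2 : n.+2%:R = n%:R + 2 :> R by rewrite -addn2 natrD.
have xn2 : 2 <= x + n.+2%:R by rewrite n2; lra.
have := loggamma_diff x0 h1 hx xn2.
rewrite -/(digamma_seq x n.+2) (gtr0_norm h0) ler_norml => /andP[_ le1].
rewrite ler_pdivrMr //.
have : 2 / (x + n.+2%:R - 1) <= 2.
  have d0 : 0 < x + n.+2%:R - 1 by rewrite n2; lra.
  by rewrite ler_pdivrMr // n2; lra.
move=> /(ler_wpM2l (ltW h0)).
move: le1; move: (digamma_seq _ _) (2 / _) => a b.
move: (2 * _ * (_ + _)) (g _) (g _) => c d e; lra.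
Qed.

Definition digamma x : R := limn (digamma_seq x).

(** As [n] grows, the first error term of [loggamma_diff] vanishes and only the quadratic one
    remains. *)
Lemma loggamma_diff_lim x h : 0 < x -> `|h| <= 1 -> `|h| <= x / 2 ->
  `|g (x + h) - g x - h * digamma x| <= 2 * h ^+ 2 * (x ^- 2 + x^-1).
Proof.
move=> x0 h1 hx; apply/ler_addgt0Pl => e e0.
have e2 : 0 < e / 2 by rewrite divr_gt0.
have dcvg := digamma_seq_cvg x0.
near \oo => n.
have nbig : 2 + 4 / e <= n%:R by near: n; exact: nbhs_infty_ger.
have dn : `|digamma x - digamma_seq x n| <= e / 2.
  by near: n; move: (e / 2) e2; exact/cvgrPdist_le.
have e4 : 0 < 4 / e by rewrite divr_gt0.
have xn2 : 2 <= x + n%:R by lra.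
have := loggamma_diff x0 h1 hx xn2; rewrite -/(digamma_seq x n) => le1.
have -> : g (x + h) - g x - h * digamma x =
  (g (x + h) - g x - h * digamma_seq x n) - h * (digamma x - digamma_seq x n).
  ring.
apply: le_trans (ler_normB _ _) _.
have le2 : `|h * (digamma x - digamma_seq x n)| <= e / 2.
  by rewrite normrM -[leRHS]mul1r ler_pM.
have le3 : `|h| * (2 / (x + n%:R - 1)) <= e / 2.
  rewrite -[leRHS]mul1r ler_pM //.
    by rewrite divr_ge0 //; lra.
  have d0 : 0 < x + n%:R - 1 by lra.
  rewrite ler_pdivrMr //.
  have : 4 / e <= x + n%:R - 1 by lra.
  by rewrite ler_pdivrMr //; lra.
move: le1 le2 le3; move: (`|_|) (`|_|) (_ * (2 / _)) (2 * _ * _) => a b c d; lra.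
Unshelve. all: by end_near. Qed.

Lemma is_derive_loggamma x : 0 < x -> is_derive x 1 g (digamma x).
Proof.
move=> x0.
have S0 : 0 < x ^- 2 + x^-1 by rewrite addr_gt0 ?invr_gt0 ?exprn_gt0.
suff lim : h^-1 *: ((g \o shift x) (h *: 1) - g x) @[h --> 0^'] --> digamma x.
  by split; [exact: cvgP lim|exact: cvg_lim lim].
apply/cvgrPdist_le => e e0; near=> h.
have hn0 : h != 0 by near: h; exact: nbhs_dnbhs_neq.
have h1 : `|h| <= 1.
  by near: h; apply: dnbhs0_le.
have hx : `|h| <= x / 2.
  by near: h; apply: dnbhs0_le; rewrite divr_gt0.
have he : `|h| <= e / (2 * (x ^- 2 + x^-1)).
  by near: h; apply: dnbhs0_le; rewrite divr_gt0 // mulr_gt0.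
rewrite /= -normrN opprB.
have -> : h *: 1 = h :> R by rewrite /GRing.scale /= mulr1.
have -> : h^-1 *: (g (h + x) - g x) - digamma x =
    h^-1 * (g (x + h) - g x - h * digamma x).
  by rewrite /GRing.scale /= (addrC h) [RHS]mulrBr mulKf.
rewrite normrM normfV ler_pdivrMl ?normr_gt0 //.
apply: le_trans (loggamma_diff_lim x0 h1 hx) _.
rewrite -real_normK ?num_real //.
move: he; rewrite ler_pdivlMr ?mulr_gt0 // => he.
have := ler_wpM2l (normr_ge0 h) he; lra.
Unshelve. all: by end_near. Qed.

End GammaLike.

(** [ln \o Gamma] satisfies both assumptions on [g], and the chain rule for [expR \o g] turns its
    derivative into the logarithmic derivative of [Gamma]. *)
Lemma Gamma_derive x : 0 < x ->
  digamma_seq x n @[n --> \oo] --> derive1 (@Gamma R) x / Gamma x.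
Proof.
move=> x0; pose g y := ln (@Gamma R y).
have gS y : 0 < y -> g (y + 1) = ln y + g y.
  by move=> y0; rewrite /g GammaS // lnM ?posrE ?Gamma_gt0.
have g_up z l : 0 < z -> 0 <= l <= 1 -> g (z + l) <= l * ln z + g z.
  move=> z0 /[dup] l01 /andP[l0 l1]; rewrite -ln_powR /g.
  have zl0 : 0 < z + l by rewrite ltr_wpDr.
  rewrite -lnM ?posrE ?powR_gt0 ?Gamma_gt0 //.
  rewrite ler_ln ?posrE ?mulr_gt0 ?powR_gt0 ?Gamma_gt0 //.
  exact: Gamma_wendel.
have dg := is_derive_loggamma gS g_up x0.
have -> : derive1 (@Gamma R) x / Gamma x = digamma x.
  have Gn0 : Gamma x != 0 by rewrite lt0r_neq0 ?Gamma_gt0.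
  apply: (mulIf Gn0); rewrite divfK // derive1E.
  rewrite (@near_eq_derive _ _ _ _ (expR \o g)) //; last first.
    near=> z; rewrite /= lnK // posrE Gamma_gt0 //.
    by near: z; exact: lt_nbhsr.
  have := @is_derive1_comp R expR g x _ _ (is_derive_expR _) dg.
  by case=> _ ->; rewrite /g lnK ?posrE ?Gamma_gt0 // mulrC.
exact: digamma_seq_cvg gS g_up _ x0.
Unshelve. all: by end_near. Qed.

Lemma invsum_asymp x (e : R) : 0 < x -> 0 < e -> \forall n \near \oo,
  `|invsum x n - (ln n%:R - derive1 (@Gamma R) x / Gamma x)| <= e.
Proof.
move=> x0 e0; have e2 : 0 < e / 2 by rewrite divr_gt0.
near=> n.
have nbig : 1 + x / (e / 2) <= n%:R by near: n; exact: nbhs_infty_ger.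
have dn : `|derive1 (@Gamma R) x / Gamma x - digamma_seq x n| <= e / 2.
  near: n; move: (e / 2) e2; apply/cvgrPdist_le; exact: Gamma_derive.
have n0 : 0 < n%:R :> R.
  by apply: lt_le_trans nbig; rewrite ltr_wpDr // divr_ge0 ?ltW.
have xn0 : 0 < x + n%:R by rewrite addr_gt0.
have := ln_diff_le n0 xn0; rewrite addrK => l1.
have l2 : ln n%:R <= ln (x + n%:R) by rewrite ler_ln ?posrE // lerDr ltW.
have l3 : x / n%:R <= e / 2.
  rewrite ler_pdivrMr // mulrC -ler_pdivrMr //.
  by apply: le_trans nbig; rewrite lerDr.
move: dn; rewrite /digamma_seq !ler_norml => /andP[].
move: l1 l2 l3; move: (derive1 (@Gamma R) x / Gamma x) (x / _).
move: (ln _) (ln _) (invsum _ _) => a b c d f.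
lra.
Unshelve. all: by end_near. Qed.

End LnGamma.

(** * The r-Stirling numbers and the r-Lah distribution *)

Section RStirling.
Variables (R : realType) (r : R).
Hypothesis r_ge0 : 0 <= r.
Implicit Types (n k j : nat).

Lemma coef_XaddC_exp (c : R) m j :
  (('X + c%:P) ^+ m)`_j = 'C(m, j)%:R * c ^+ (m - j).
Proof.
rewrite addrC exprDn coef_sum.
under eq_bigr => i _ do rewrite coefMn -polyC_exp coefCM coefXn.
have [jm|jm] := leqP j m; last first.
  rewrite bin_small // mul0r big1 // => i _.
  rewrite (_ : (j == i) = false) /= ?mulr0 ?mul0rn //.
  by apply: gtn_eqF; exact: leq_ltn_trans (leq_ord i) jm.
rewrite (bigD1 (Ordinal (jm : (j < m.+1)%N))) //= eqxx mulr1 mulr_natl.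
rewrite big1 ?addr0 // => i ij.
by rewrite eq_sym (_ : (i == j :> nat) = false) /= ?mulr0 ?mul0rn //; exact/negbTE.
Qed.

(** Substituting ['X + r] for ['X] in the rising factorial and expanding the powers gives the
    defining sum. *)
Lemma rstirling1_coef n j :
  rstirling1 r n j = (\prod_(i < n) ('X + (r + i%:R)%:P))`_j.
Proof.
have -> : \prod_(i < n) ('X + (r + i%:R)%:P) =
    \sum_(m < n.+1) (stirling1 n m)%:R *: ('X + r%:P) ^+ m :> {poly R}.
  have := congr1 (comp_poly ('X + r%:P)) (stirling1_poly R n).
  rewrite rmorph_prod /= raddf_sum /= => E.
  rewrite (eq_bigr (fun i : 'I_n => ('X + i%:R%:P) \Po ('X + r%:P))); last first.
    by move=> i _; rewrite comp_polyD comp_polyX comp_polyC polyCD addrA.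
  by rewrite -E; apply: eq_bigr => m _; rewrite comp_polyZ comp_Xn_poly.
rewrite coef_sum /rstirling1 (big_nat_widenl _ 0) // big_mkcond big_mkord.
apply: eq_bigr => m _; rewrite coefZ coef_XaddC_exp mulrA /=.
by case: leqP => // mj; rewrite bin_small // mulr0 mul0r.
Qed.

Lemma rstirling1_gtn n j : (n < j)%N -> rstirling1 r n j = 0.
Proof. by move=> nj; rewrite /rstirling1 big_geq. Qed.

Lemma rstirling1_diag n : rstirling1 r n n = 1.
Proof.
elim: n => [|n IH]; first by rewrite rstirling1_coef big_ord0 coef1.
rewrite rstirling1_coef big_ord_recr /= mulrDr coefD coefMX coefMC /=.
by rewrite -!rstirling1_coef IH rstirling1_gtn // mul0r addr0.
Qed.

Lemma stirling2_rec_gt n k : (n < k)%N -> stirling2_rec n k = 0%N.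
Proof.
elim: n k => [|n IH] [|k] //= nk.
by rewrite (IH k.+1 (ltnW nk)) (IH k nk) muln0.
Qed.

Lemma rstirling2E n k : rstirling2 r n k =
  \sum_(j < n.+1) 'C(n, j)%:R * (stirling2_rec j k)%:R * r ^+ (n - j).
Proof.
rewrite /rstirling2 (big_nat_widenl _ 0) // big_mkcond big_mkord.
apply: eq_bigr => j _; rewrite stirling2E /=.
by case: leqP => // jk; rewrite stirling2_rec_gt // mulr0 mul0r.
Qed.

(** Pascal's rule; it transfers the recursion in [n] from the ordinary to the [r]-Stirling
    numbers. *)
Lemma binomial_transformS (a : nat -> R) n :
  \sum_(j < n.+2) 'C(n.+1, j)%:R * a j * r ^+ (n.+1 - j) =
  r * (\sum_(j < n.+1) 'C(n, j)%:R * a j * r ^+ (n - j)) +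
  \sum_(j < n.+1) 'C(n, j)%:R * a j.+1 * r ^+ (n - j).
Proof.
rewrite big_ord_recl /= bin0 subn0 mul1r.
under eq_bigr => j _ do rewrite /bump /= add1n binS subSS natrD !mulrDl.
rewrite big_split /= addrA; congr (_ + _).
rewrite big_ord_recr /= (bin_small (leqnn n.+1)) !mul0r addr0.
rewrite [in RHS]big_ord_recl /= bin0 subn0 mul1r mulrDr mulr_sumr.
congr (_ + _); first by rewrite exprS mulrCA.
apply: eq_bigr => j _; rewrite /bump /= add1n.
by rewrite mulrCA -exprS subnSK.
Qed.

Lemma rstirling2_0 n : rstirling2 r n 0 = r ^+ n.
Proof.
rewrite rstirling2E big_ord_recl /= bin0 subn0 !mul1r big1 ?addr0 // => i _.
by rewrite mulr0 mul0r.
Qed.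

Lemma rstirling2_0S k : rstirling2 r 0 k.+1 = 0.
Proof. by rewrite rstirling2E big_ord1 /= mulr0 mul0r. Qed.

Lemma rstirling2S n k : rstirling2 r n.+1 k.+1 =
  (k.+1%:R + r) * rstirling2 r n k.+1 + rstirling2 r n k.
Proof.
rewrite !rstirling2E (binomial_transformS (fun j => (stirling2_rec j k.+1)%:R)).
rewrite mulrDl addrC -addrA [r * _ + _]addrC addrA; congr (_ + _).
rewrite mulr_sumr -big_split /=; apply: eq_bigr => j _.
by rewrite natrD natrM; ring.
Qed.

Lemma rstirling2_ge0 n k : 0 <= rstirling2 r n k.
Proof. by apply: sumr_ge0 => j _; rewrite !mulr_ge0 // exprn_ge0. Qed.

Lemma rstirling2_gt n k : (n < k)%N -> rstirling2 r n k = 0.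
Proof. by move=> nk; rewrite /rstirling2 big_geq. Qed.

Lemma rstirling2_leS n k : (k%:R + r) * rstirling2 r n k <= rstirling2 r n.+1 k.
Proof.
case: k => [|k]; first by rewrite add0r !rstirling2_0 exprS.
by rewrite rstirling2S lerDl rstirling2_ge0.
Qed.

Lemma rstirling2_diag k : rstirling2 r k k = 1.
Proof.
elim: k => [|k IH]; first by rewrite rstirling2_0.
by rewrite rstirling2S IH rstirling2_gt // mulr0 add0r.
Qed.

Lemma rstirling2_ge n k : (k%:R + r) ^+ n <= rstirling2 r (k + n) k.
Proof.
elim: n => [|n IH]; first by rewrite addn0 rstirling2_diag.
rewrite exprS addnS (le_trans _ (rstirling2_leS _ _)) //.
by rewrite ler_wpM2l // addr_ge0.
Qed.

(** For [k + 1] the induction on [n] needs the sharper bound with [(k%:R + r) ^+ n] subtracted,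
    which the recursion reproduces exactly. *)
Lemma rstirling2_le n k : rstirling2 r n k <= (k%:R + r) ^+ n.
Proof.
elim: k n => [|k IHk] n; first by rewrite rstirling2_0 add0r.
suff : rstirling2 r n k.+1 <= (k.+1%:R + r) ^+ n - (k%:R + r) ^+ n.
  move=> /le_trans; apply; rewrite lerBlDr lerDl exprn_ge0 // addr_ge0 //.
elim: n => [|n IH]; first by rewrite rstirling2_0S subrr.
rewrite rstirling2S !exprS; have := IHk n.
have kr : 0 <= k.+1%:R + r by rewrite addr_ge0.
have := ler_wpM2l kr IH; rewrite -natr1.
move: (_ ^+ n) (_ ^+ n) (rstirling2 _ _ _) (rstirling2 _ _ _) => a b c d; lra.
Qed.

End RStirling.

(** An explicit form of exponential decay: even after multiplication by [j + 1], the ratio of the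
    powers of [t - 1] and [t] is [O(1 / j)]. *)
Lemma expr_decay_le (R : realType) (t : R) j : 1 <= t ->
  j.+1%:R * (t - 1) ^+ j <= 4 * t ^+ 2 / (2 * t + j%:R) * t ^+ j.
Proof.
move=> t1; have t0 : 0 < t by lra.
have q0 : 0 <= 1 - t^-1 by rewrite subr_ge0 invf_le1.
have -> : (t - 1) ^+ j = (1 - t^-1) ^+ j * t ^+ j.
  by rewrite -exprMn mulrBl mulVf ?lt0r_neq0 // mul1r.
rewrite [leLHS]mulrA; apply: ler_wpM2r; first by rewrite exprn_ge0 ?ltW.
(* Half of the exponent [j / t]: [(1 - 1/t) ^ j <= y ^ -2], while [y] grows at least linearly in
   [j], so that [y ^ 2] absorbs two factors of order [j]. *)
pose y := expR (j%:R / (2 * t)).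
have y1 : (2 * t + j%:R) / (2 * t) <= y.
  apply: le_trans (expR_ge1Dx _); rewrite mulrDl divff // lt0r_neq0 // mulr_gt0 //.
have y0 : 0 < y by exact: expR_gt0.
have qy : (1 - t^-1) ^+ j * y ^+ 2 <= 1.
  have -> : y ^+ 2 = expR (t^-1) ^+ j.
    rewrite /y -!expRM_natl; congr expR; field; exact: lt0r_neq0.
  rewrite -exprMn exprn_ile1 //; first by rewrite mulr_ge0 // expR_ge0.
  rewrite -[leRHS](expRxMexpNx_1 (t^-1)) mulrC ler_pM2l ?expR_gt0 //.
  exact: expR_ge1Dx.
have d0 : 0 < 2 * t + j%:R by rewrite ltr_pwDl // mulr_gt0.
set Q := (1 - t^-1) ^+ j in qy *.
have Q0 : 0 <= Q by rewrite exprn_ge0.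
rewrite ler_pdivlMr //.
have j1 : j.+1%:R <= 2 * t + j%:R by rewrite -natr1; lra.
move: y1; rewrite ler_pdivrMr ?mulr_gt0 // => y1.
have s1 : (2 * t + j%:R) ^+ 2 <= (y * (2 * t)) ^+ 2.
  have yt0 : 0 < y * (2 * t) by rewrite !mulr_gt0.
  by rewrite ler_sqr // nnegrE ltW.
have : j.+1%:R * Q * (2 * t + j%:R) <= (2 * t + j%:R) ^+ 2 * Q.
  rewrite mulrAC ler_wpM2r // expr2 ler_wpM2r // ltW //.
move=> /le_trans; apply; apply: le_trans (ler_wpM2r Q0 s1) _.
have t2 : 0 <= 4 * t ^+ 2 by rewrite mulr_ge0 ?sqr_ge0.
have := ler_wpM2l t2 qy; rewrite exprMn; lra.
Qed.

(** For [k = 0] the sequence is geometric. Otherwise the recursion leaves the excess term with lower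
    index [k - 1], at most [(t - 1) ^ j], against a main term of order at least [t ^ (j - k)]. *)
Lemma rstirling2_ratio (R : realType) (r : R) (k : nat) : 0 <= r ->
  0 < Num.max k%:R r -> exists J : nat, forall j, (J <= j)%N ->
  j.+1%:R * rstirling2 r j.+1 k <=
    (j.+1%:R + 16^-1) * ((k%:R + r) * rstirling2 r j k).
Proof.
move=> r0; case: k => [_|k _].
  exists 0%N => j _; rewrite !rstirling2_0 add0r -exprS.
  by rewrite ler_wpM2r ?exprn_ge0 // lerDl.
set t := k.+1%:R + r; have t1 : 1 <= t by rewrite /t -natr1; have := ler0n R k; lra.
have t0 : 0 < t by lra.
(* Here 64 is the 4 of [expr_decay_le] times the 16 of the target slack. *)
pose J := (k.+1 + (Num.truncn (64 * t ^+ k.+2)).+1)%N.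
exists J => j Jj; rewrite rstirling2S // -/t mulrDr [leRHS]mulrDl lerD2l.
have kj : (k.+1 <= j)%N by apply: leq_trans Jj; rewrite leq_addr.
have bt : t ^+ j <= t ^+ k.+1 * rstirling2 r j k.+1.
  rewrite -{1}(subnKC kj) exprD ler_pM2l ?exprn_gt0 //.
  by have := rstirling2_ge r0 (j - k.+1) k.+1; rewrite subnKC.
have := expr_decay_le j t1.
have -> : t - 1 = k%:R + r by rewrite /t -natr1; ring.
have := rstirling2_le r0 j k => /(ler_wpM2l (ler0n R j.+1)) /le_trans h {}/h.
move=> /le_trans; apply.
have jJ : 64 * t ^+ k.+2 <= j%:R.
  apply: le_trans (ltW (truncnS_gt _)) _; rewrite ler_nat.
  by apply: leq_trans Jj; rewrite leq_addl.
have d0 : 0 < 2 * t + j%:R by rewrite ltr_pwDl // mulr_gt0.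
rewrite mulrAC ler_pdivrMr //.
have t2 : 0 <= 4 * t ^+ 2 by rewrite mulr_ge0 ?sqr_ge0.
apply: le_trans (ler_wpM2l t2 bt) _.
have b0 := rstirling2_ge0 r0 j k.+1.
have tb0 : 0 <= t * rstirling2 r j k.+1 by rewrite mulr_ge0 // ltW.
have : 4 * t ^+ 2 * (t ^+ k.+1 * rstirling2 r j k.+1) =
   16^-1 * (t * rstirling2 r j k.+1) * (64 * t ^+ k.+2).
  by rewrite !exprS; field.
move=> ->; apply: ler_wpM2l; first by rewrite mulr_ge0.
by apply: le_trans jJ _; rewrite lerDr mulr_ge0 // ltW.
Qed.

(** * First-kind [r]-Stirling numbers as probabilities of independent trials *)

Section RLahWeights.
Variables (R : realType) (r t : R).
Hypotheses (r_ge0 : 0 <= r) (t_gt0 : 0 < t).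

Definition lah_prob n (i : 'I_n) : R := t / (t + r + i%:R).

Lemma lah_prob01 n (i : 'I_n) : 0 <= lah_prob i <= 1.
Proof.
have d0 : 0 < t + r + i%:R by rewrite ltr_wpDr // ltr_wpDr.
rewrite /lah_prob; apply/andP; split; first by apply: divr_ge0; exact: ltW.
rewrite ler_pdivrMr // mul1r.
by rewrite -addrA lerDl addr_ge0.
Qed.

Lemma comp_poly_scaleX_coef (p : {poly R}) (c : R) j :
  (p \Po (c *: 'X))`_j = c ^+ j * p`_j.
Proof.
rewrite comp_polyE coef_sum.
under eq_bigr => i _ do rewrite exprZn !coefZ coefXn.
have [jp|jp] := ltnP j (size p); last first.
  rewrite (nth_default _ jp) mulr0 big1 // => i _.
  rewrite (_ : (j == i) = false) /= ?mulr0 //.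
  by apply: gtn_eqF; exact: leq_trans (ltn_ord i) jp.
rewrite (bigD1 (Ordinal jp)) //= eqxx mulr1 mulrC big1 ?addr0 // => i ij.
by rewrite eq_sym (_ : (i == j :> nat) = false) /= ?mulr0 //; exact/negbTE.
Qed.

(** Substituting [t *: 'X] for ['X] multiplies the [j]-th coefficient by [t ^+ j] and turns each
    linear factor into [t + r + i] times the generating factor of a trial. *)
Lemma rstirling1_pb n j :
  t ^+ j * rstirling1 r n j =
  (\prod_(i < n) (t + r + i%:R)) * pb_coef (@lah_prob n) [set: 'I_n] j.
Proof.
rewrite rstirling1_coef.
transitivity (((\prod_(i < n) ('X + (r + i%:R)%:P)) \Po (t *: 'X))`_j).
  by rewrite comp_poly_scaleX_coef.
rewrite /pb_coef -coefCM rmorph_prod /=.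
rewrite rmorph_prod /= /pb_poly.
rewrite (@eq_bigl _ _ _ _ _ (fun i : 'I_n => i \in [set: 'I_n]) xpredT); last first.
  by move=> i; rewrite finset.in_setT.
rewrite -big_split /=; congr (polyseq _)`_j; apply: eq_bigr => i _.
have d0 : t + r + i%:R != 0 by rewrite lt0r_neq0 // ltr_wpDr // ltr_wpDr.
rewrite comp_polyD comp_polyX comp_polyC mulrDr -polyCM mulrA -polyCM.
rewrite addrC mul_polyC; congr (_%:P + _ *: _).
  by rewrite /lah_prob; field.
by rewrite /lah_prob mulrC divfK.
Qed.

End RLahWeights.

Lemma lah_prob_mean (R : realType) (r t : R) n :
  pb_mean (lah_prob r t (n := n)) [set: 'I_n] = t * invsum (t + r) n.
Proof.
rewrite /pb_mean /invsum mulr_sumr; apply: eq_bigl => i.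
by rewrite finset.in_setT.
Qed.

Lemma lah_prob_sqr_sum (R : realType) (r t : R) n : 0 <= r -> 0 < t ->
  \sum_(i in [set: 'I_n]) lah_prob r t i ^+ 2 <=
    t ^+ 2 * ((t + r) ^- 2 + (t + r)^-1).
Proof.
move=> r0 t0; have tr0 : 0 < t + r by rewrite ltr_wpDr.
apply: le_trans _ (ler_wpM2l (sqr_ge0 t) (sum_inv_sqr_le n tr0)).
rewrite mulr_sumr (eq_bigl xpredT); last by move=> i; rewrite finset.in_setT.
by apply: ler_sum => i _; rewrite /lah_prob exprMn exprVn.
Qed.

Lemma rstirling1_ge0 (R : realType) (r : R) n j : 0 <= r -> 0 <= rstirling1 r n j.
Proof.
by move=> r0; apply: sumr_ge0 => i _; rewrite !mulr_ge0 // exprn_ge0.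
Qed.

(** * Maximizers in terms of unnormalized weights *)

Section Maximizer.
Variables (R : realType) (r : R) (n k : nat).
Hypotheses (r_ge0 : 0 <= r) (kn : (k <= n)%N) (kr_gt0 : 0 < k%:R + r).

Definition rlah_weight j : R := rstirling1 r n j * rstirling2 r j k.

Lemma rlah_weight_ge0 j : 0 <= rlah_weight j.
Proof. by rewrite mulr_ge0 ?rstirling1_ge0 ?rstirling2_ge0. Qed.

Lemma rlah_weight_diag_gt0 : 0 < rlah_weight n.
Proof.
rewrite /rlah_weight rstirling1_diag // mul1r.
have := rstirling2_ge r_ge0 (n - k) k; rewrite subnKC //.
by apply: lt_le_trans; rewrite exprn_gt0.
Qed.

Lemma rlah_gt0 : 0 < rlah r n k.
Proof.
rewrite /rlah big_nat_recr //=; apply: ltr_wpDl; last exact: rlah_weight_diag_gt0.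
by apply: sumr_ge0 => j _; exact: rlah_weight_ge0.
Qed.

(** Off the support one of the two Stirling factors vanishes, so no case distinction remains. *)
Lemma rlah_pmfE j : rlah_pmf r n k j = (rlah r n k)^-1 * rlah_weight j.
Proof.
rewrite /rlah_pmf; case: ifP => // /negbT; rewrite negb_and -!ltnNge /rlah_weight.
case/orP => [jk|nj]; first by rewrite rstirling2_gt ?mulr0.
by rewrite rstirling1_gtn ?mul0r ?mulr0.
Qed.

Lemma rlah_weightE j : (k%:R + r) ^+ j * rlah_weight j =
  (\prod_(i < n) (k%:R + r + r + i%:R)) *
  (pb_coef (lah_prob r (k%:R + r) (n := n)) [set: 'I_n] j * rstirling2 r j k).
Proof. by rewrite /rlah_weight mulrA rstirling1_pb // mulrA. Qed.

Lemma maximizer_weight i : is_maximizer (rlah_pmf r n k) i ->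
  0 < rlah_weight i /\ forall j, rlah_weight j <= rlah_weight i.
Proof.
move=> imax; have le_w j : rlah_weight j <= rlah_weight i.
  by have := imax j; rewrite !rlah_pmfE ler_pM2l // invr_gt0 rlah_gt0.
by split=> //; apply: lt_le_trans (le_w n); exact: rlah_weight_diag_gt0.
Qed.

End Maximizer.

(** * From the location of the mode to the floor and ceiling *)

Lemma near_floor_ceil (R : realType) (x : R) (i : nat) :
  `|i%:R - x| < 1 -> i%:Z = Num.floor x \/ i%:Z = Num.ceil x.
Proof.
rewrite ltr_norml => /andP[lo hi].
have [ix|xi] := leP (i%:R : R) x.
  by left; apply/esym/floor_def; rewrite intrD -!pmulrn; lra.
by right; apply/esym/ceil_def; rewrite intrB -!pmulrn; lra.
Qed.

Theorem proposition3p21 (R : realType) (r : R) (k : nat)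
    (r_ge0 : 0 <= r) (kr_gt0 : 0 < Num.max k%:R r) :
  exists N : nat, (0 < N)%N /\
    forall n : nat, (N < n)%N ->
      forall i : nat, is_maximizer (rlah_pmf r n k) i ->
        i%:Z = Num.floor (rlah_mode_approx r n k) \/
        i%:Z = Num.ceil (rlah_mode_approx r n k).
Proof.
have t_gt0 : 0 < k%:R + r.
  move: kr_gt0; rewrite lt_max => /orP[|] h; first by rewrite ltr_wpDr.
  by rewrite ltr_wpDl.
have [J ratio] := rstirling2_ratio r_ge0 kr_gt0.
set t := k%:R + r in t_gt0 ratio.
have x_gt0 : 0 < t + r by rewrite ltr_wpDr.
pose psi := derive1 (@Gamma R) (t + r) / Gamma (t + r).
pose C := t ^+ 2 * ((t + r) ^- 2 + (t + r)^-1).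
pose M := 12 + 40 * C + J%:R + 32 * (C * (3 + 6 * C)).
have M_gt0 : 0 < M.
  have C0 : 0 <= C.
    by rewrite mulr_ge0 ?sqr_ge0 // addr_ge0 // invr_ge0 ?exprn_ge0 // ltW.
  have CC0 : 0 <= C * (3 + 6 * C) by rewrite mulr_ge0 //; lra.
  by have := ler0n R J; rewrite /M; lra.
(* For large [n] the support is nonempty, the mean is within 1/8 of [t * (ln n - psi)], and this
   value is at least [M + 1/8]; so the mean is at least [M], as [m_large] demands. *)
have [N _ HN] : (\forall n \near \oo%classic, [/\ (k <= n)%N,
    `|invsum (t + r) n - (ln n%:R - psi)| <= (8 * t)^-1 &
    (M + 8^-1) / t + psi <= ln n%:R])%classic.
  near=> n; split.
  - by near: n; exact: nbhs_infty_ge.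
  - near: n; apply: invsum_asymp => //.
    by rewrite invr_gt0 mulr_gt0.
  - rewrite -ler_expR lnK; last first.
      by rewrite posrE ltr0n; near: n; exact: nbhs_infty_gt.
    by near: n; exact: nbhs_infty_ger.
exists N.+1; split=> // n Nn i imax.
have [kn asymp lnbig] := HN n (ltnW (ltnW Nn)).
have [wi0 le_w] := maximizer_weight r_ge0 kn t_gt0 imax.
pose pr := lah_prob r t (n := n).
have prC : \sum_(l in [set: 'I_n]) pr l ^+ 2 <= C by exact: lah_prob_sqr_sum.
have pr01 l : 0 <= pr l <= 1 by exact: lah_prob01.
pose b j := rstirling2 r j k.
have bS j : t * b j <= b j.+1 by exact: rstirling2_leS.
have mE : pb_mean pr [set: 'I_n] = t * invsum (t + r) n by exact: lah_prob_mean.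
have mclose : `|pb_mean pr [set: 'I_n] - t * (ln n%:R - psi)| <= 8^-1.
  rewrite mE -mulrBr normrM gtr0_norm // -ler_pdivlMl //.
  by rewrite -invfM mulrC.
have M_le : M <= pb_mean pr [set: 'I_n].
  move: mclose; rewrite ler_norml => /andP[mlo _].
  have := ler_wpM2l (ltW t_gt0) lnbig.
  rewrite mulrDr mulrCA divff ?lt0r_neq0 // mulr1.
  move: mlo; move: (pb_mean _ _) (ln _) => m l; lra.
have P0 : 0 < \prod_(l < n) (t + r + l%:R) by apply: prodr_gt0 => l _; rewrite ltr_wpDr.
have wE j := rlah_weightE n r_ge0 t_gt0 j; rewrite -/t -/pr in wE.
have := wi0; rewrite -(pmulr_rgt0 _ (exprn_gt0 i t_gt0)) wE pmulr_rgt0 // => pb0.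
have bi0 : 0 < b i.
  by rewrite lt_def rstirling2_ge0 // andbT; apply: contraTneq pb0 => bi;
    rewrite -/(b i) bi mulr0 ltxx.
have pi0 : 0 < pb_coef pr [set: 'I_n] i by move: pb0; rewrite pmulr_lgt0.
(* Scaled by [t ^+ j.+1], the weights at [j] and [j.+1] share the positive constant factor and take
   the form compared in [mode_lower] and [mode_upper]. *)
have step j : (t ^+ j * rlah_weight r n k j) * t = (\prod_(l < n) (t + r + l%:R)) *
    (pb_coef pr [set: 'I_n] j * (t * b j)) by rewrite wE /b; ring.
have tt j : 0 <= t ^+ j * t by rewrite mulr_ge0 ?exprn_ge0 // ltW.
have low := @mode_lower R _ pr C t b J pr01 t_gt0 prC bS M_le i pi0 bi0.
have {low} : pb_mean pr [set: 'I_n] - 4^-1 < i.+1%:R.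
  apply: low; rewrite -(ler_pM2l P0) -wE -step exprSr.
  by rewrite [leRHS]mulrAC; apply: ler_wpM2l.
have up : i%:R < pb_mean pr [set: 'I_n] + 4^-1.
  (* [mode_upper] compares [i] with its predecessor; for [i = 0] the bound follows from the size of
     the mean. *)
  case: i imax wi0 le_w pb0 bi0 pi0 => [|i] imax wi0 le_w pb0 bi0 pi0.
    by apply: lt_le_trans _ (lerD M_le (lexx _)); rewrite ltr_wpDr.
  have := @mode_upper R _ pr C t b J pr01 prC ratio M_le i pi0 bi0.
  apply; rewrite -(ler_pM2l P0) -wE -step exprSr.
  by rewrite [leLHS]mulrAC; apply: ler_wpM2l.
move=> low; apply: near_floor_ceil.
have -> : rlah_mode_approx r n k = t * (ln n%:R - psi) - 2^-1.
  rewrite /rlah_mode_approx -/t; have -> : k%:R + 2 * r = t + r by rewrite /t; ring.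
  by rewrite -mulrA -/psi div1r; ring.
have iE : i.+1%:R = i%:R + 1 :> R by rewrite -natr1.
move: mclose low up; rewrite iE !ler_norml ltr_norml => /andP[].
(* The half shift centres the interval [(m - 5/4, m + 1/4)] for [i]: with the error 1/8 of the mean,
   the distance stays below 3/4 + 1/8 = 7/8. *)
move: (pb_mean _ _) (t * _) => m l; lra.
Unshelve. all: by end_near. Qed.
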